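(* Let $G$ be a graph and let $S \subseteq V_G$ be a cycle cover of $G$. Let $H$ be a graph obtained from $G$ by adding at least one whisker at each vertex in $S$, and let $J = J(H)$ be the cover ideal of $H$. Then the symbolic power $J^{(k)}$ is Koszul for all $k \ge 1$.
   Context: All graphs are finite, simple and undirected; $V_G$ and $E_G$ denote the vertex set and edge set of $G$. A cycle is a closed path $x_1, x_2, \dots, x_m, x_1$ with $x_1,\dots,x_m$ distinct ($m\ge 3$). A subset $S \subseteq V_G$ is a cycle cover of $G$ if the induced subgraph $G \setminus S$ on $V_G \setminus S$ has no cycle. Adding a whisker at a vertex $x$ of $G$ means adding a new vertex $y$ to $V_G$ and the new edge $\{x,y\}$ to $E_G$. Let $\Bbbk$ be an infinite field. The vertices of a graph $H$ are identified with the variables of a polynomial ring $R$ over $\Bbbk$. A vertex cover of $H$ is a subset $W \subseteq V_H$ meeting every edge of $H$. The cover ideal of $H$ is $J(H) = \langle x_{i_1}\cdots x_{i_r} \mid \{x_{i_1},\dots,x_{i_r}\} \text{ is a vertex cover of } H\rangle \subseteq R$. For an ideal $I \subseteq R$ and $k \ge 1$, the $k$-th symbolic power is $I^{(k)} = \bigcap_{\mathfrak p \in \operatorname{Ass}(R/I)} (I^k R_{\mathfrak p} \cap R)$. Let $\mathfrak m$ be the homogeneous maximal ideal of $R$. A finitely generated $R$-module $M$ is Koszul if its associated graded module $\operatorname{gr}_{\mathfrak m}(M) = \bigoplus_{i\ge 0} \mathfrak m^i M/\mathfrak m^{i+1}M$ has a linear resolution over $\operatorname{gr}_{\mathfrak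 m}(R) = \bigoplus_{i \ge 0} \mathfrak m^i/\mathfrak m^{i+1}$. An ideal of $R$ is Koszul if it is Koszul as an $R$-module. (It is known that a homogeneous ideal of $R$ is Koszul if and only if it is componentwise linear.) *)

(* Defs.v *)
From HB Require Import structures.
From mathcomp Require Import mpoly.
From mathcomp Require Import all_boot all_order all_algebra.
From mathcomp Require Import boolp.

Set Implicit Arguments.
Unset Strict Implicit.
Unset Printing Implicit Defensive.

Import GRing.Theory.
Local Open Scope ring_scope.
Local Open Scope quotient_scope.

(** * Graphs *)

Record sgraph := SGraph {
  svertex :> finType;
  sedge : rel svertex;
  sedge_sym : symmetric sedge;
  sedge_irr : irreflexive sedge }.

Definition acyclic (G : sgraph) : Prop :=
  forall c : seq G, (2 < size c)%N -> ~ ucycle (@sedge G) c.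

Section Delete.
Variables (G : sgraph) (S : {set G}).

Definition del_vertex : finType := {x : G | x \notin S}.
Definition del_edge : rel del_vertex := fun x y => sedge (val x) (val y).

Fact del_sym : symmetric del_edge.
Proof. by move=> x y; rewrite /del_edge sedge_sym. Qed.

Fact del_irr : irreflexive del_edge.
Proof. by move=> x; rewrite /del_edge sedge_irr. Qed.

Definition del : sgraph := SGraph del_sym del_irr.
End Delete.

Definition cycle_cover (G : sgraph) (S : {set G}) : Prop := acyclic (del S).

(* [whisker G w] is G with [w x] whiskers added at each vertex x; the vertex
   [inr (Tagged _ i)] with tag x is the end of the i-th whisker at x. *)
Section Whisker.
Variables (G : sgraph) (w : G -> nat).

Definition whisker_vertex : finType := (G + {x : G & 'I_(w x)})%type.

Definition whisker_edge : rel whisker_vertex := fun u v =>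
  match u, v with
  | inl x, inl y => sedge x y
  | inl x, inr t => x == tag t
  | inr t, inl x => x == tag t
  | inr _, inr _ => false
  end.

Fact whisker_sym : symmetric whisker_edge.
Proof. by move=> [x|t] [y|u] //=; exact: sedge_sym. Qed.

Fact whisker_irr : irreflexive whisker_edge.
Proof. by move=> [x|t] //=; exact: sedge_irr. Qed.

Definition whisker : sgraph := SGraph whisker_sym whisker_irr.
End Whisker.

Definition vertex_cover (H : sgraph) (W : {set H}) : Prop :=
  forall x y : H, sedge x y -> (x \in W) || (y \in W).

(** * Ideals of a commutative ring, as predicates *)

Section Ideals.
Variable R : comNzRingType.
Implicit Types (I J : R -> Prop) (X : R -> Prop).

Definition is_ideal I : Prop :=
  [/\ I 0, forall x y, I x -> I y -> I (x + y) & forall a x, I x -> I (a * x)].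

Definition is_prime I : Prop :=
  [/\ is_ideal I, ~ I 1 & forall x y, I (x * y) -> I x \/ I y].

Definition ideal_gen X : R -> Prop := fun x =>
  exists s : seq (R * R),
    (forall c, c \in s -> X c.2) /\ x = \sum_(c <- s) c.1 * c.2.

Definition ideal_mul I J : R -> Prop :=
  ideal_gen (fun x => exists a b, [/\ I a, J b & x = a * b]).

Fixpoint ideal_pow I (k : nat) : R -> Prop :=
  if k is k'.+1 then ideal_mul I (ideal_pow I k') else fun=> True.

(* p is in Ass(R/I): p is prime and is the annihilator of the class of some f *)
Definition associated_prime I (p : R -> Prop) : Prop :=
  is_prime p /\ exists f, forall x, p x <-> I (x * f).

Lemma ideal_gen_sub X x : X x -> ideal_gen X x.
Proof.
move=> Xx; exists [:: (1, x)]; split; last by rewrite big_seq1 mul1r.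
by move=> c; rewrite inE => /eqP ->.
Qed.

Lemma ideal_gen0 X : ideal_gen X 0.
Proof. by exists [::]; rewrite big_nil. Qed.

Lemma ideal_genD X x y : ideal_gen X x -> ideal_gen X y -> ideal_gen X (x + y).
Proof.
move=> [s [sX ->]] [t [tX ->]]; exists (s ++ t); rewrite big_cat; split=> // c.
by rewrite mem_cat => /orP[/sX|/tX].
Qed.

Lemma ideal_genM X a x : ideal_gen X x -> ideal_gen X (a * x).
Proof.
move=> [s [sX ->]]; exists [seq (a * c.1, c.2) | c <- s]; split.
  by move=> _ /mapP[c /sX ? ->].
by rewrite big_map mulr_sumr; apply: eq_bigr => c _; rewrite mulrA.
Qed.

Lemma ideal_genP X : is_ideal (ideal_gen X).
Proof.
by split; [exact: ideal_gen0 | exact: ideal_genD | exact: ideal_genM].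
Qed.

Lemma ideal_gen_min X I x :
  is_ideal I -> (forall y, X y -> I y) -> ideal_gen X x -> I x.
Proof.
move=> [I0 ID IM] XI [s [sX ->]]; rewrite big_seq.
by elim/big_ind: _ => // c /sX /XI; exact: IM.
Qed.

Lemma ideal_powP I k : is_ideal (ideal_pow I k).
Proof. by case: k => [|k]; [split | exact: ideal_genP]. Qed.

Lemma ideal_mulM I J a b : I a -> J b -> ideal_mul I J (a * b).
Proof. by move=> Ia Jb; apply: ideal_gen_sub; exists a, b. Qed.

Lemma ideal_powD I i j a b :
  ideal_pow I i a -> ideal_pow I j b -> ideal_pow I (i + j) (a * b).
Proof.
elim: i a => [|i IH] a.
  by move=> _; have [_ _] := ideal_powP I j; apply.
move=> Ia Ib; have [P0 PD PM] := ideal_powP I (i.+1 + j).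
apply: (ideal_gen_min (I := fun a => ideal_pow I (i.+1 + j) (a * b))) Ia.
  by split=> [|x y|c x]; rewrite ?mul0r ?mulrDl -?mulrA; auto.
move=> _ [x [y [Ix Iy ->]]]; rewrite -mulrA.
by apply: ideal_mulM => //; exact: IH.
Qed.

(* the i-th step m^i I of the m-adic filtration of I *)
Definition adic (m I : R -> Prop) (i : nat) : R -> Prop :=
  ideal_mul (ideal_pow m i) I.

Lemma adic_ideal m I i : is_ideal (adic m I i).
Proof. exact: ideal_genP. Qed.

Lemma adicM m I i j a x :
  adic m (fun=> True) i a -> adic m I j x -> adic m I (i + j) (a * x).
Proof.
have [P0 PD PM] := adic_ideal m I (i + j).
move=> Ha Hx.
apply: (ideal_gen_min (I := fun a => adic m I (i + j) (a * x))) Ha.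
  by split=> [|u v|c u]; rewrite ?mul0r ?mulrDl -?mulrA; auto.
move=> _ [a' [r [Ha' _ ->]]].
apply: (ideal_gen_min (I := fun x => adic m I (i + j) (a' * r * x))) Hx.
  split=> [|u v|c u]; rewrite ?mulr0 ?mulrDr; auto.
  by rewrite mulrCA; auto.
move=> _ [b [y [Hb Hy ->]]]; rewrite mulrACA [r * y]mulrC mulrA [_ * r]mulrC.
by apply: PM; apply: ideal_mulM => //; exact: ideal_powD.
Qed.

End Ideals.

(* I^(k): x lies in I^k R_p iff, in the fraction field of R, x = a / s with
   a in I^k and s outside p *)
Definition symbolic_power (R : idomainType) (I : R -> Prop) (k : nat) :
  R -> Prop := fun x =>
  forall p, associated_prime I p ->
    exists a s, [/\ ideal_pow I k a, ~ p s &
      FracField.tofrac x = FracField.tofrac a / FracField.tofrac s].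

(** * Associated graded modules

   The direct sum of the m^i I / m^(i+1) I is realized as the quotient of the
   group of polynomials sum_i c_i t^i with c_i in m^i I, by the subgroup of
   those with c_i in m^(i+1) I; multiplication is induced by that of R[t]. *)

Section Graded.
Variables (R : comNzRingType) (m : R -> Prop).

Section GradedGroup.
Variable I : R -> Prop.

Definition rees_pred : {pred {poly R}} :=
  fun p => `[< forall i, adic m I i p`_i >].

Fact rees_pred_closed : zmod_closed rees_pred.
Proof.
split=> [|p q /asboolP Hp /asboolP Hq]; apply/asboolP => i.
  by rewrite coef0; exact: ideal_gen0.
rewrite coefB -mulN1r; exact: ideal_genD (Hp i) (ideal_genM _ (Hq i)).
Qed.
HB.instance Definition _ :=
  GRing.isZmodClosed.Build {poly R} rees_pred rees_pred_closed.

Record rees := Rees { rees_val :> {poly R}; _ : rees_val \in rees_pred }.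
HB.instance Definition _ := [isSub for rees_val].
HB.instance Definition _ := [Choice of rees by <:].
HB.instance Definition _ := [SubChoice_isSubZmodule of rees by <:].

Definition rees_next : {pred rees} :=
  fun p => `[< forall i, adic m I i.+1 (rees_val p)`_i >].

Fact rees_next_closed : zmod_closed rees_next.
Proof.
split=> [|p q /asboolP Hp /asboolP Hq]; apply/asboolP => i.
  by rewrite coef0; exact: ideal_gen0.
rewrite coefB -mulN1r; exact: ideal_genD (Hp i) (ideal_genM _ (Hq i)).
Qed.
HB.instance Definition _ :=
  GRing.isZmodClosed.Build rees rees_next rees_next_closed.

Definition gr : Type := Quotient.quot rees_next.
HB.instance Definition _ := GRing.Zmodule.on gr.
HB.instance Definition _ := EqQuotient.on gr.

Definition gr_class (p : rees) : gr := \pi_gr p.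

(* the component m^d I / m^(d+1) I *)
Definition gr_piece (d : nat) : gr -> Prop := fun u =>
  exists (c : R) (p : rees), rees_val p = c *: 'X^d /\ u = gr_class p.

Lemma gr_classP (p q : rees) :
  gr_class p = gr_class q <-> forall i, adic m I i.+1 (rees_val p - rees_val q)`_i.
Proof.
split=> [/eqP|H]; last apply/eqP; rewrite /gr_class.
  by rewrite -Quotient.idealrBE => /asboolP.
by rewrite -Quotient.idealrBE; apply/asboolP.
Qed.

Lemma gr_class_repr (u : gr) : gr_class (repr u) = u.
Proof. exact: reprK. Qed.

Lemma gr_classD p q : gr_class (p + q) = gr_class p + gr_class q.
Proof. by rewrite /gr_class [LHS]Quotient.pi_add. Qed.

End GradedGroup.

Definition gr_ring : Type := gr (fun=> True).
HB.instance Definition _ := GRing.Zmodule.on gr_ring.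

Fact rees_mul_proof I (a : rees (fun=> True)) (p : rees I) :
  rees_val a * rees_val p \in rees_pred I.
Proof.
case: a p => [a /asboolP Ha] [p /asboolP Hp] /=; apply/asboolP => i.
rewrite coefM; elim/big_ind: _ => [|x y|j _].
- exact: ideal_gen0.
- exact: ideal_genD.
by have := adicM (Ha j) (Hp (i - j)%N); rewrite subnKC // -ltnS.
Qed.

Definition rees_mul I a p : rees I := Rees (rees_mul_proof a p).

Definition gr_mul I (a : gr_ring) (u : gr I) : gr I :=
  gr_class (rees_mul (repr a) (repr u)).

Lemma gr_mulE I (a : rees (fun=> True)) (p : rees I) :
  gr_mul (gr_class a) (gr_class p) = gr_class (rees_mul a p).
Proof.
rewrite /gr_mul; set a' := repr _; set p' := repr _.
have /gr_classP Ha : gr_class a' = gr_class a by rewrite gr_class_repr.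
have /gr_classP Hp : gr_class p' = gr_class p by rewrite gr_class_repr.
have /asboolP Hp'0 := valP p'; have /asboolP Ha0 := valP a.
apply/gr_classP => i.
have -> : rees_val (rees_mul a' p') - rees_val (rees_mul a p) =
  (rees_val a' - rees_val a) * rees_val p' +
  rees_val a * (rees_val p' - rees_val p).
  by rewrite /= mulrBl mulrBr addrA subrK.
rewrite coefD !coefM; apply: ideal_genD.
all: elim/big_ind: _ => [|x y|j _]; [exact: ideal_gen0 | exact: ideal_genD |].
  have := adicM (Ha j) (Hp'0 (i - j)%N).
  by rewrite addSn subnKC // -ltnS.
have := adicM (Ha0 j) (Hp (i - j)%N).
by rewrite addnS subnKC // -ltnS.
Qed.

Fact rees_one_proof : 1 \in rees_pred (fun=> True).
Proof.
apply/asboolP => i; rewrite coef1; case: i => [|i]; last exact: ideal_gen0.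
by rewrite -[1%:R](mul1r 1); apply: ideal_mulM.
Qed.

Definition gr_one : gr_ring := gr_class (Rees rees_one_proof).

Let grI I (P : gr I -> Prop) : (forall p, P (gr_class p)) -> forall u, P u.
Proof. by move=> H u; rewrite -[u]gr_class_repr. Qed.

Lemma gr_mulA I (a b : gr_ring) (u : gr I) :
  gr_mul a (gr_mul b u) = gr_mul (gr_mul a b) u.
Proof.
elim/grI: a => a; elim/grI: b => b; elim/grI: u => u; rewrite !gr_mulE.
by congr gr_class; apply: val_inj; rewrite /= mulrA.
Qed.

Lemma gr_mul1 I : left_id gr_one (@gr_mul I).
Proof.
elim/grI => u; rewrite gr_mulE.
by congr gr_class; apply: val_inj; rewrite /= mul1r.
Qed.

Lemma gr_mulDr I : right_distributive (@gr_mul I) +%R.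
Proof.
move=> a u v; elim/grI: a => a; elim/grI: u => u; elim/grI: v => v.
rewrite -gr_classD !gr_mulE -gr_classD.
by congr gr_class; apply: val_inj; rewrite /= mulrDr.
Qed.

Lemma gr_mulDl I (u : gr I) : {morph (@gr_mul I)^~ u : a b / a + b}.
Proof.
move=> a b; elim/grI: a => a; elim/grI: u => u; elim/grI: b => b.
rewrite -gr_classD !gr_mulE -gr_classD.
by congr gr_class; apply: val_inj; rewrite /= mulrDl.
Qed.

Fact gr_ring_mulA : associative (@gr_mul (fun=> True) : gr_ring -> gr_ring -> gr_ring).
Proof. by move=> a b c; exact: gr_mulA. Qed.

Fact gr_ring_mulC : commutative (@gr_mul (fun=> True) : gr_ring -> gr_ring -> gr_ring).
Proof.
move=> a b; elim/grI: a => a; elim/grI: b => b; rewrite !gr_mulE.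
by congr gr_class; apply: val_inj; rewrite /= mulrC.
Qed.

Fact gr_ring_mulDl :
  left_distributive (@gr_mul (fun=> True) : gr_ring -> gr_ring -> gr_ring) +%R.
Proof. by move=> a b c; exact: gr_mulDl. Qed.

HB.instance Definition _ := GRing.Zmodule_isComPzRing.Build gr_ring
  gr_ring_mulA gr_ring_mulC (@gr_mul1 (fun=> True)) gr_ring_mulDl.

HB.instance Definition _ I := GRing.Zmodule_isLmodule.Build gr_ring (gr I)
  (@gr_mulA I) (@gr_mul1 I) (@gr_mulDr I) (@gr_mulDl I).

End Graded.

(** * Koszul ideals *)

(* For a graded ring A with components gA and a graded A-module N with
   components gN: there is an exact complex of graded maps of degree 0
     ... -> A(-d-2)^b_2 -> A(-d-1)^b_1 -> A(-d)^b_0 -> N -> 0.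
   A map A(-d-i-1)^b_(i+1) -> A(-d-i)^b_i is right multiplication of row
   vectors by a matrix with entries in degree 1, and A(-d)^b_0 -> N is given
   by b_0 elements of N of degree d. *)
Definition has_linear_resolution (A : comPzRingType) (gA : nat -> A -> Prop)
    (N : lmodType A) (gN : nat -> N -> Prop) : Prop :=
  exists (d : nat) (b : nat -> nat) (phi : forall i, 'M[A]_(b i.+1, b i))
         (e : 'I_(b 0%N) -> N),
  let eps (v : 'rV[A]_(b 0%N)) := \sum_j v 0 j *: e j in
  [/\ (forall i r c, gA 1%N (phi i r c)) /\ (forall j, gN d (e j)),
      forall y : N, exists v, eps v = y,
      forall v, eps v = 0 <-> exists w, v = w *m phi 0%N &
      forall i (v : 'rV[A]_(b i.+1)), v *m phi i = 0 <-> exists w, v = w *m phi i.+1].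

Definition koszul (R : comNzRingType) (m I : R -> Prop) : Prop :=
  has_linear_resolution (A := gr_ring m) (@gr_piece R m (fun=> True))
    (@gr_piece R m I).

(** * Cover ideals *)

Definition max_homog_ideal (K : fieldType) (n : nat) : {mpoly K[n]} -> Prop :=
  ideal_gen (fun f => exists i : 'I_n, f = 'X_i).

(* the vertex x of H is identified with the variable of index [enum_rank x] *)
Definition cover_ideal (K : fieldType) (H : sgraph) :
  {mpoly K[#|H|]} -> Prop :=
  ideal_gen (fun f => exists2 W : {set H},
    vertex_cover W & f = \prod_(x in W) 'X_(enum_rank x)).

Definition infinite_field (K : fieldType) : Prop :=
  forall s : seq K, exists x, x \notin s.

(* Main.v *)
(* The associated primes of the cover ideal J are the (x, y) for x y an edge,
   so J^(k) is spanned by the monomials m with m_x + m_y >= k on every edge.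
   For edge weights W such that some y is adjacent to a leaf, linear quotients
   for the minimal monomials with m_x + m_y >= W(x, y) reduce to the same
   question for two smaller weights: those divisible by y come first and correspond to W lowered by 1 on
   the edges at y; in the others the neighbours v of y have exponent at least
   W(y, v), and dividing these forced powers out isolates y. Both operations
   preserve the shape "forest plus vertices carrying a dominant whisker", which
   always provides such a y.
   Linear quotients make the syzygies of gr(I) a submodule of a free module
   whose initial module is generated by variable multiples of basis vectors,
   with linear lifts. The syzygies of those lifts are again of this kind, so
   the linear resolution is produced one step at a time. *)

From HB Require Import structures.
Require Import Defs.
From mathcomp Require Import all_boot all_order all_algebra.
From mathcomp Require Import mpoly.
From mathcomp Require Import boolp zify.

Set Implicit Arguments.
Unset Strict Implicit.
Unset Printing Implicit Defensive.

(** * Weighted covers *)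

Section WeightedCovers.
Variable n : nat.
Implicit Types (W : 'I_n -> 'I_n -> nat) (a u v : 'X_{1..n}) (s : seq 'X_{1..n}).

Definition lin_quotients (C : 'X_{1..n} -> Prop) s : Prop :=
  [/\ forall u, u \in s -> C u,
      forall a, C a -> exists2 u, u \in s & (u <= a)%MM &
      forall i j, i < j < size s -> exists l x, [/\ l < j,
        nth 0%MM s j x < nth 0%MM s i x,
        (nth 0%MM s l <= nth 0%MM s j + U_(x))%MM &
        nth 0%MM s l <> (nth 0%MM s j + U_(x))%MM]].

Definition wcover W a : Prop := forall x y, W x y <= a x + a y.

(** For covers, with [W] symmetric and zero on the diagonal, this is minimality. *)
Definition tight W a : Prop :=
  forall x, 0 < a x -> exists y, a x + a y = W x y.

Definition shift W (l : 'X_{1..n}) x y := W x y - (l x + l y).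

Lemma wcover_shift W (l : 'X_{1..n}) a : wcover (shift W l) a <-> wcover W (a + l)%MM.
Proof.
by split=> H x y; have := H x y; rewrite /shift !mnmDE; lia.
Qed.

(** Covers divisible by [X_y] come first; the others have exponent at least [W y v] at each [v], so
    [l] divides them. Tightness is carried along because it makes the divisors in [lin_quotients]
    proper. *)
Lemma lin_quotients_leaf W y z s1 s2 (l := [multinom W y x | x < n]) :
  (forall x x', W x x' = W x' x) -> (forall x, W x x = 0) ->
  0 < W y z -> (forall x, x != y -> W z x = 0) ->
  lin_quotients (wcover (shift W U_(y)%MM)) s1 ->
  (forall u, u \in s1 -> tight (shift W U_(y)%MM) u) ->
  lin_quotients (wcover (shift W l)) s2 ->
  (forall u, u \in s2 -> tight (shift W l) u) ->
  let s := [seq (u + U_(y))%MM | u <- s1] ++ [seq (u + l)%MM | u <- s2] in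
  lin_quotients (wcover W) s /\ forall u, u \in s -> tight W u.
Proof.
move=> Wsym W0 Wyz leaf [c1 g1 q1] t1 [c2 g2 q2] t2 s.
have lE x : l x = W y x by rewrite mnmE.
have yz : y != z by apply: contraTneq Wyz => <-; rewrite W0.
(* Dividing by [l] reduces every weight at [y] to 0, so a tight exponent at [y] is 0. *)
have s2y u : u \in s2 -> u y = 0.
  move=> us; case: (posnP (u y)) => // u0.
  have [x] := t2 u us _ u0; rewrite /shift !lE W0; lia.
have ts u : u \in s -> tight W u.
  rewrite mem_cat => /orP[] /mapP[{}u us ->] x; rewrite !mnmDE ?mnm1E ?lE.
    case: (eqVneq y x) => [<- _|yx ux].
      (* If [u y = 0], the equality at [y] comes from the leaf edge: every other weight at [z] is 0,
         so [u z = 0] or tightness at [z] makes the edge [y z] tight. *)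
      case: (posnP (u y)) => u0.
        exists z; rewrite mnmDE mnm1E (negbTE yz).
        have := (wcover_shift W _ u).1 (c1 u us) y z.
        rewrite !mnmDE !mnm1E eqxx (negbTE yz).
        case: (posnP (u z)) => uz; first by lia.
        have [x'] := t1 u us _ uz; rewrite /shift !mnm1E (negbTE yz).
        case: (eqVneq y x') => [<-|yx]; last by rewrite leaf 1?eq_sym //; lia.
        by rewrite Wsym; lia.
      have [x'] := t1 u us _ u0; rewrite /shift !mnm1E eqxx.
      case: (eqVneq y x') => [<-|yx]; first by rewrite W0; lia.
      by exists x'; rewrite mnmDE mnm1E (negbTE yx); lia.
    have {}ux : 0 < u x by lia.
    have [x'] := t1 u us _ ux; rewrite /shift !mnm1E (negbTE yx) => e.
    by exists x'; rewrite mnmDE mnm1E; lia.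
  case: (posnP (u x)) => [ux0 lx|ux0 _].
    by exists y; rewrite mnmDE lE W0 (s2y _ us) Wsym; lia.
  have [x' e] := t2 u us _ ux0; exists x'; move: e.
  by rewrite mnmDE !lE /shift !lE; lia.
split=> //; split.
- by move=> u; rewrite mem_cat => /orP[] /mapP[v vs ->]; apply/wcover_shift; auto.
- move=> a Ca; case: (posnP (a y)) => ay.
    have la : (l <= a)%MM.
      by apply/mnm_lepP => x; have := Ca y x; rewrite lE ay.
    have [|u us ul] := g2 (a - l)%MM; first by apply/wcover_shift; rewrite submK.
    exists (u + l)%MM; first by rewrite mem_cat (map_f (fun u => (u + l)%MM)) ?orbT.
    apply/mnm_lepP => x; have /mnm_lepP/(_ x) := ul; have /mnm_lepP/(_ x) := la.
    by rewrite mnmDE mnmBE; lia.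
  have la : (U_(y) <= a)%MM by rewrite lep1mP -lt0n.
  have [|u us ul] := g1 (a - U_(y))%MM; first by apply/wcover_shift; rewrite submK.
  exists (u + U_(y))%MM.
    by rewrite mem_cat (map_f (fun u => (u + U_(y))%MM)).
  apply/mnm_lepP => x; have /mnm_lepP/(_ x) := ul; have /mnm_lepP/(_ x) := la.
  by rewrite mnmDE mnmBE; lia.
have n1 i : i < size s1 -> nth 0%MM s i = (nth 0%MM s1 i + U_(y))%MM.
  by move=> lt; rewrite nth_cat size_map lt (nth_map 0%MM).
have n2 i : i < size s2 -> nth 0%MM s (size s1 + i) = (nth 0%MM s2 i + l)%MM.
  by move=> lt; rewrite nth_cat size_map ifN -?leqNgt ?leq_addr // addKn (nth_map 0%MM).
move=> i j; rewrite size_cat !size_map => /andP[ij js].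
(* Properness is automatic: if [u_k = u_j * X_x], lowering [x] in [u_k] leaves the cover [u_j],
   against tightness. *)
suff [k [x [kj lt le]]] : exists k x, [/\ k < j,
    nth 0%MM s j x < nth 0%MM s i x &
    (nth 0%MM s k <= nth 0%MM s j + U_(x))%MM].
  exists k, x; split=> // e.
  have ks : nth 0%MM s k \in s by rewrite mem_nth // size_cat !size_map; lia.
  have cj : wcover W (nth 0%MM s j).
    have: nth 0%MM s j \in s by rewrite mem_nth // size_cat !size_map.
    by rewrite mem_cat => /orP[] /mapP[v vs ->]; apply/wcover_shift; auto.
  have [|x'] := ts _ ks x; first by rewrite e mnmDE mnm1E eqxx addn1.
  by rewrite e !mnmDE !mnm1E eqxx; have := cj x x'; lia.
have [js1|js1] := ltnP j (size s1).
  have [|k [x [kj lt /mnm_lepP le _]]] := q1 i j; first by rewrite ij.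
  exists k, x; split; rewrite // !n1; try by rewrite ?mnmDE; lia.
  by apply/mnm_lepP => x'; have := le x'; rewrite !mnmDE; lia.
have [j' ej] : {j' | j = size s1 + j'} by exists (j - size s1); lia.
have js2 : j' < size s2 by lia.
have us2 : nth 0%MM s2 j' \in s2 by rewrite mem_nth.
(* Across the two blocks the variable is [y]: [u_j] is also a cover for the lowered weights, so some
   [u] in [s1] divides it, and [u * X_y] divides [u_j * X_y]. *)
have [is1|is1] := ltnP i (size s1).
  have [|u us /mnm_lepP le] := g1 (nth 0%MM s2 j' + l)%MM.
    by have := (wcover_shift _ _ _).1 (c2 _ us2) => H x x'; have := H x x'; rewrite /shift; lia.
  exists (index u s1), y; have lt : index u s1 < size s1 by rewrite index_mem.
  split; first by lia.
    by rewrite ej n2 // n1 // !mnmDE s2y // lE W0 mnm1E eqxx; lia.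
  rewrite ej n2 // n1 // nth_index //.
  by apply/mnm_lepP => x'; have := le x'; rewrite !mnmDE; lia.
have [i' ei] : {i' | i = size s1 + i'} by exists (i - size s1); lia.
have [|k [x [kj lt /mnm_lepP le _]]] := q2 i' j'; first by lia.
exists (size s1 + k), x; rewrite ei ej; split; first by lia.
  by rewrite !n2 ?mnmDE; lia.
rewrite !n2; try lia.
by apply/mnm_lepP => x'; have := le x'; rewrite !mnmDE; lia.
Qed.

Lemma lin_quotients0 W : (forall x y, W x y = 0) ->
  lin_quotients (wcover W) [:: 0%MM] /\ forall u, u \in [:: 0%MM] -> tight W u.
Proof.
move=> W0; split; first split.
- by move=> u _ x y; rewrite W0.
- by move=> a _; exists 0%MM; rewrite ?inE //; apply/mnm_lepP => x; rewrite mnm0E.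
- by move=> i j /andP[]; case: j.
by move=> u; rewrite inE => /eqP -> x; rewrite mnm0E.
Qed.

End WeightedCovers.

(** Without a leaf every simple path extends at its start by a vertex other than the second one.
    Acyclicity makes that vertex new, so simple paths would outgrow [T]. *)
Lemma acyclic_leaf (T : finType) (e : rel T) (x0 y0 : T) :
    ssrbool.symmetric e -> irreflexive e ->
    (forall c, 2 < size c -> ~ ucycle e c) -> e x0 y0 ->
  exists y z, e y z /\ forall x, e z x -> x = y.
Proof.
move=> esym eirr acyc e0; apply: contrapT => noleaf.
have step x y : e x y -> exists2 x', e x x' & x' != y.
  move=> exy; apply: contrapT => H; apply: noleaf; exists y, x.
  split=> [|x' exx']; first by rewrite esym.
  by apply/eqP; apply: contrapT => /negP ne; apply: H; exists x'.
have long m : exists x y p, [/\ size p = m, path e x (y :: p) &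
    uniq [:: x, y & p]].
  elim: m => [|m [x [y [p [sz pth un]]]]].
    exists x0, y0, [::]; rewrite /= e0 inE !andbT; split=> //.
    by apply: contraTneq e0 => ->; rewrite eirr.
  have [|x' exx' x'y] := step x y; first by case/andP: pth.
  exists x', x, (y :: p); rewrite [size _]/= sz; split=> //.
    by rewrite [path _ _ _]/= esym exx' -/(path e x (y :: p)).
  rewrite [uniq _]/= -/(uniq [:: x, y & p]) un andbT.
  rewrite !inE (negbTE x'y) /=; apply/orP => -[/eqP x'x|x'p].
    by rewrite x'x eirr in exx'.
  (* If [x'] is already on the path, the segment [x, y, ..., x'] closes to a cycle of at least three
     vertices. *)
  case/splitPr: x'p pth un sz => p1 p2 pth un _.
  apply: (acyc [:: x, y & rcons p1 x']); first by rewrite /= size_rcons.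
  move: pth un; rewrite /ucycle -cat_rcons.
  rewrite -[y :: _ ++ _]/((y :: rcons p1 x') ++ p2).
  rewrite -[[:: x, y & _ ++ _]]/([:: x, y & rcons p1 x'] ++ p2).
  rewrite cat_path cat_uniq => /andP[pth _] /andP[-> _]; rewrite andbT.
  rewrite [cycle _ _]/= rcons_path -/(path e x (y :: rcons p1 x')).
  by move: pth => /= /andP[-> ->] /=; rewrite last_rcons esym.
have [x [y [p [sz _ /card_uniqP un]]]] := long #|T|.
by have := max_card (mem [:: x, y & p]); rewrite un /= sz leqNgt ltnS leqnSn.
Qed.

(** * Weights on a forest with dominant whiskers *)

Section WhiskeredForest.
Variables (n : nat) (e : rel 'I_n) (S : pred 'I_n) (end_of : 'I_n -> 'I_n).
Hypotheses (e_sym : ssrbool.symmetric e) (e_irr : irreflexive e).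
Hypothesis end_notin : forall x, S x -> ~~ S (end_of x).
Hypothesis end_leaf : forall x y, S x -> e (end_of x) y -> y = x.
Hypothesis acyclic_off : forall c, 2 < size c -> all (predC S) c -> ~ ucycle e c.

(** Edges of weight 0 count as absent. Domination by the whisker isolates [x] as soon as its whisker
    has weight 0. *)
Definition admissible (W : 'I_n -> 'I_n -> nat) : Prop :=
  [/\ forall x y, W x y = W y x, forall x y, 0 < W x y -> e x y &
      forall x y, S x -> W x y <= W x (end_of x)].

(** If [l] vanishes at the whisker end, the whisker loses only [l x], and any other edge at [x]
    loses at least as much. In the other case all weights at [x] become 0. *)
Lemma admissible_shift W (l : 'X_{1..n}) : admissible W ->
  (forall x, S x -> l (end_of x) = 0 \/ forall y, W x y <= l x + l y) ->
  admissible (shift W l).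
Proof.
move=> [sym sub dom] Hl; rewrite /shift; split=> [x y|x y|x y Sx].
- by rewrite sym [l x + _]addnC.
- by move=> H; apply: sub; lia.
by have := dom x y Sx; have [|/(_ y)] := Hl x Sx; lia.
Qed.

(** Induction on the total weight: both shifts make the edge [y z] lighter. *)
Lemma admissible_lin_quotients W : admissible W ->
  exists s, lin_quotients (wcover W) s /\ forall u, u \in s -> tight W u.
Proof.
pose wt W := \sum_(p : 'I_n * 'I_n) W p.1 p.2.
have [m] := ubnP (wt W); elim: m W => // m IH W wtW admW.
have [sym sub dom] := admW.
have W0 x : W x x = 0.
  by case: (posnP (W x x)) => // /sub; rewrite e_irr.
have [/existsP[x0 /existsP[y0 W00]]|none] := boolP [exists x, exists y, 0 < W x y];
  last first.
  exists [:: 0%MM]; apply: lin_quotients0 => x y; apply/eqP; rewrite -leqn0 leqNgt.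
  by apply: contra none => H; apply/existsP; exists x; apply/existsP; exists y.
(* The last clause, that [y] is no whisker end, keeps whiskers dominant when the weights at [y] drop
   by 1. *)
have [y [z [Wyz leaf yend]]] : exists y z, [/\ 0 < W y z,
    forall x, x != y -> W z x = 0 & forall x, S x -> end_of x != y].
  have [/existsP[s /andP[Ss /existsP[v Wsv]]]|iso] :=
    boolP [exists x, S x && [exists y, 0 < W x y]].
    exists s, (end_of s); split; first by have := dom s v Ss; lia.
      move=> x xs; case: (posnP (W (end_of s) x)) => // /sub /(end_leaf Ss) xe.
      by rewrite xe eqxx in xs.
    by move=> x Sx; apply: contraTneq Ss => <-; apply: end_notin.
  (* Now all of [S] is isolated, so the edges of positive weight form a forest, and a leaf of it
     serves as [z]. *)
  have {}iso x y : S x -> W x y = 0.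
    move=> Sx; apply/eqP; rewrite -leqn0 leqNgt; apply: contra iso => H.
    by apply/existsP; exists x; rewrite Sx; apply/existsP; exists y.
  have [y [z [Wyz leaf]]] : exists y z, 0 < W y z /\ forall x, 0 < W z x -> x = y.
    apply: (acyclic_leaf _ _ _ W00) => [x y|x|c sz /andP[cyc un]].
    - by rewrite sym.
    - by rewrite W0.
    apply: (acyclic_off sz).
      apply/allP => x xc; rewrite inE; apply/negP => /(iso x (next c x)) Wx.
      by have := next_cycle cyc xc; rewrite Wx.
    by rewrite /ucycle un andbT; apply: sub_cycle cyc.
  exists y, z; split=> //.
    move=> x xy; case: (posnP (W z x)) => // /leaf xe; by rewrite xe eqxx in xy.
  move=> x Sx; apply/eqP => ey; have := Wyz; rewrite -ey => /sub /(end_leaf Sx) zx.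
  by move: Wyz; rewrite sym zx iso.
pose l := [multinom W y x | x < n].
have wtlt l' : 0 < (l' : 'X_{1..n}) y + l' z -> wt (shift W l') < m.
  move=> lyz; apply: leq_trans (_ : wt W <= m); last by [].
  rewrite /wt (bigD1 (y, z)) // [X in _ < X](bigD1 (y, z)) //= -addSn leq_add //.
    by rewrite /shift; lia.
  by apply: leq_sum => p _; rewrite /shift leq_subr.
have [||s1 [q1 t1]] := IH (shift W U_(y)%MM).
- by apply: wtlt; rewrite mnm1E eqxx.
- apply: admissible_shift => // x Sx; left.
  by rewrite mnm1E eq_sym (negbTE (yend x Sx)).
have [||s2 [q2 t2]] := IH (shift W l).
- by apply: wtlt; rewrite !mnmE; lia.
- apply: admissible_shift => // x Sx; rewrite !mnmE.
  (* A positive weight here forces [y = x], and then [l] cancels every weight at [x]. *)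
  case: (posnP (W y (end_of x))) => [->|Wye]; [by left | right=> x'].
  have <- : y = x by apply: end_leaf => //; rewrite e_sym sub.
  by rewrite !mnmE W0.
by eexists; apply: lin_quotients_leaf Wyz leaf q1 t1 q2 t2.
Qed.

End WhiskeredForest.

(** * Symbolic powers of cover ideals *)

Import GRing.Theory.
Local Open Scope ring_scope.

(** * Monomial ideals and gradings given by a measure *)

Section MonomialIdeals.
Variables (K : fieldType) (n : nat).
Local Notation R := {mpoly K[n]}.
Implicit Types (C : 'X_{1..n} -> Prop) (P : R -> Prop) (f g : R).

Definition monomial_ideal C f : Prop := forall m, m \in msupp f -> C m.

Lemma monomial_idealX C m : monomial_ideal C 'X_[m] <-> C m.
Proof.
rewrite /monomial_ideal msuppX; split=> [|Cm m']; first by apply; rewrite inE.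
by rewrite inE => /eqP ->.
Qed.

Lemma monomial_idealP C :
  (forall m m', (m <= m')%MM -> C m -> C m') -> is_ideal (monomial_ideal C).
Proof.
move=> up; split=> [m|f g Cf Cg m /msuppD_le|a f Cf m /msuppM_le].
- by rewrite msupp0.
- by rewrite mem_cat => /orP[/Cf|/Cg].
case/allpairsP => -[m1 m2] /= [_ /Cf Cm2 ->]; apply: up Cm2.
exact: lem_addl.
Qed.

Lemma mpoly_ideal_ind P f :
  is_ideal P -> (forall m, m \in msupp f -> P 'X_[m]) -> P f.
Proof.
move=> [P0 PD PM] H; rewrite [f]mpolyE big_seq.
by elim/big_ind: _ => // m /H Pm; rewrite -mul_mpolyC; apply: PM.
Qed.

(** For [edge_deg i j] with [i != j] this is the power [(X_i, X_j)^k]; for [mdeg] it is the [k]-th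
    power of the maximal ideal. *)
Definition order_ideal (mf : measure n) k := monomial_ideal (fun m => k <= mf m)%N.

Lemma order_idealP mf k : is_ideal (order_ideal mf k).
Proof.
apply: monomial_idealP => m m' /submK <-; rewrite mfD; lia.
Qed.

Lemma order_idealM (mf : measure n) i j f g :
  order_ideal mf i f -> order_ideal mf j g -> order_ideal mf (i + j) (f * g).
Proof.
move=> Hf Hg m /msuppM_le/allpairsP[[m1 m2] /= [/Hf H1 /Hg H2 ->]].
by rewrite mfD; lia.
Qed.

(* The substitution X_i |-> X_i t^(mf U_i), whose coefficients in t are the
   homogeneous components for the grading given by mf. *)
Definition gsplit (mf : measure n) : R -> {poly R} :=
  mmap (polyC \o @mpolyC n K) (fun i => ('X_i)%:P * 'X^(mf U_(i)%MM)).

HB.instance Definition _ mf := GRing.RMorphism.on (gsplit mf).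

Lemma gsplitB (mf : measure n) f g : gsplit mf (f - g) = gsplit mf f - gsplit mf g.
Proof. exact: raddfB. Qed.

Lemma gsplitX (mf : measure n) m : gsplit mf 'X_[m] = 'X_[m] *: 'X^(mf m).
Proof.
rewrite /gsplit mmapX /mmap1.
under eq_bigr do rewrite exprMn -rmorphXn -exprM.
rewrite big_split /= -rmorph_prod -mul_polyC mpolyXE_id prodrXr; congr (_ * 'X^ _).
by rewrite mfE; apply: eq_bigr => i _; rewrite mulnC.
Qed.

Lemma coef_gsplit (mf : measure n) f t : (gsplit mf f)`_t = pihomog mf t f.
Proof.
rewrite {1}[f]mpolyE raddf_sum coef_sum [f in RHS]mpolyE raddf_sum.
apply: eq_bigr => m _ /=; rewrite linearZ /= pihomogX.
rewrite -mul_mpolyC rmorphM /= gsplitX {1}/gsplit mmapC coefCM coefZ coefXn eq_sym.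
by case: eqP => _; rewrite ?mulr1 ?mulr0 -?mul_mpolyC ?mulr0.
Qed.

Lemma mcoeff_pihomog (mf : measure n) f t m :
  (pihomog mf t f)@_m = if mf m == t then f@_m else 0.
Proof.
rewrite pihomogE raddf_sum /= big_mkcond [f in RHS]mpolyE raddf_sum /=.
case: ifP => mt; [apply: eq_bigr | rewrite big1 //] => m' _;
  rewrite !mcoeffZ mcoeffX; case: (m' =P m) => [->|_];
  by rewrite ?mt // mulr0 if_same.
Qed.

(** Compare lowest components: [f] has a nonzero component [f_0], and if [g] starts in degree
    [t < k], the component of [f * g] in degree [t] is [f_0 * g_t], nonzero in a domain. *)
Lemma order_ideal_prime (mf : measure n) k f g :
  order_ideal mf k (f * g) -> ~ order_ideal mf 1 f -> order_ideal mf k g.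
Proof.
move=> Hfg Hf; apply: contrapT => Hg.
have [m mg mk] : exists2 m, m \in msupp g & (mf m < k)%N.
  apply: contrapT => H; apply: Hg => m mg; rewrite leqNgt; apply/negP => mk.
  by apply: H; exists m.
have f0 : pihomog mf 0 f != 0.
  apply/eqP => f0; apply: Hf => m' m'f; rewrite lt0n; apply/eqP => mf0.
  have := congr1 (mcoeff m') f0; rewrite mcoeff_pihomog mf0 mcoeff0 eqxx => /eqP.
  by apply/negP; rewrite -mcoeff_msupp.
have ex : exists t, pihomog mf t g != 0.
  exists (mf m); apply: contraTneq mg => /(congr1 (mcoeff m)).
  by rewrite mcoeff_pihomog eqxx mcoeff0 mcoeff_msupp negbK => ->.
have [t gt tmin] := ex_minnP ex.
have tk : (t < k)%N.
  apply: leq_ltn_trans mk; apply: tmin; apply: contraTneq mg.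
  move=> /(congr1 (mcoeff m)).
  by rewrite mcoeff_pihomog eqxx mcoeff0 mcoeff_msupp negbK => ->.
have : pihomog mf t (f * g) = pihomog mf 0 f * pihomog mf t g.
  rewrite -!coef_gsplit rmorphM coefM big_ord_recl subn0 big1 ?addr0 //= => i _.
  rewrite [X in _ * X]coef_gsplit; case: (eqVneq (pihomog mf (t - bump 0 i) g) 0) => [->|].
    by rewrite mulr0.
  by move=> /tmin; rewrite /bump /=; have := ltn_ord i; lia.
move=> /eqP; rewrite eq_sym; apply/negP.
suff -> : pihomog mf t (f * g) = 0 by rewrite mulf_neq0.
apply/mpolyP => m'; rewrite mcoeff_pihomog mcoeff0; case: eqP => // mt.
by apply: memN_msupp_eq0; apply/negP => /Hfg; rewrite mt; lia.
Qed.

End MonomialIdeals.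

Section EdgeDegree.
Variables (n : nat) (i j : 'I_n).

Definition edge_deg (m : 'X_{1..n}) : nat := (m i + m j)%N.

Fact edge_deg0 : edge_deg 0%MM = 0%N.
Proof. by rewrite /edge_deg !mnm0E. Qed.

Fact edge_degD : {morph edge_deg : m m' / (m + m')%MM >-> (m + m')%N}.
Proof. by move=> m m'; rewrite /edge_deg !mnmDE addnACA. Qed.

HB.instance Definition _ := isMeasure.Build n edge_deg edge_deg0 edge_degD.
End EdgeDegree.

Lemma edge_deg_split n (i j : 'I_n) (m : 'X_{1..n}) k :
  i != j -> (k <= edge_deg i j m)%N ->
  exists a b, k = (a + b)%N /\ (U_(i) *+ a + U_(j) *+ b <= m)%MM.
Proof.
rewrite /edge_deg => ij km; exists (minn k (m i)), (k - minn k (m i))%N.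
split; [lia | apply/mnm_lepP => x]; rewrite mnmDE !mulmnE !mnm1E.
have [<-|ix] := eqVneq i x; first by rewrite eq_sym (negbTE ij); lia.
by have [<-|jx] := eqVneq j x; lia.
Qed.

Lemma ideal_powX (R : comNzRingType) (I : R -> Prop) c k :
  I c -> ideal_pow I k (c ^+ k).
Proof. by move=> Ic; elim: k => //= k IH; rewrite exprS; apply: ideal_mulM. Qed.

(** * Symbolic powers as intersections of powers of edge primes *)

Section SymbolicPowers.
Variables (K : fieldType) (H : sgraph).
Local Notation R := {mpoly K[#|H|]}.
Local Notation J := (@cover_ideal K H).
Local Notation rk := (@enum_rank H).
Implicit Types (x y : H) (f g : R) (k : nat).

Definition edge_ideal x y := order_ideal (K := K) (edge_deg (rk x) (rk y)).

Lemma edge_ideal_is_ideal x y k : is_ideal (edge_ideal x y k).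
Proof. exact: order_idealP. Qed.

Lemma prod_varE (P : pred H) :
  \prod_(x | P x) 'X_(rk x) = 'X_[(\sum_(x | P x) U_(rk x))%MM] :> R.
Proof. by rewrite mprodXE. Qed.

Lemma mnm_sum_varE (P : pred H) x :
  (\sum_(x | P x) U_(rk x))%MM (rk x) = P x.
Proof.
rewrite mnm_sumE big_mkcond (bigD1 x) //= mnm1E eqxx big1 ?addn0; first by case: (P x).
move=> y yx; case: ifP => // _; rewrite mnm1E.
by rewrite (inj_eq enum_rank_inj) (negbTE yx).
Qed.

Lemma cover_ideal_is_ideal : is_ideal J.
Proof. exact: ideal_genP. Qed.

Lemma cover_ideal_edge x y f : sedge x y -> J f -> edge_ideal x y 1 f.
Proof.
move=> xy; apply: ideal_gen_min; first exact: edge_ideal_is_ideal.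
move=> _ [W /(_ x y xy) Wxy ->]; rewrite prod_varE; apply/monomial_idealX.
rewrite /= /edge_deg !(mnm_sum_varE (fun z => z \in W)).
by move: Wxy; case: (x \in W); case: (y \in W).
Qed.

(** The support of a monomial lying in every edge prime is a vertex cover, whose squarefree monomial
    divides it. *)
Lemma cover_idealP f :
  (forall x y, sedge x y -> edge_ideal x y 1 f) -> J f.
Proof.
move=> Hf; have [J0 JD JM] := cover_ideal_is_ideal.
apply: mpoly_ideal_ind => [|m mf]; first by split.
pose W := [set x : H | 0 < m (rk x)]%N.
have Wm : (\sum_(x in W) U_(rk x) <= m)%MM.
  apply/mnm_lepP => i; rewrite -[i]enum_valK.
  by rewrite (mnm_sum_varE (fun z => z \in W)) inE; case: (m _).
rewrite -(submK Wm) mpolyXD; apply: JM; apply: ideal_gen_sub.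
exists W; last by rewrite prod_varE.
move=> x y xy; have := Hf x y xy m mf; rewrite !inE /= /edge_deg.
by case: (m _).
Qed.

Lemma edge_ideal_prime x y : sedge x y -> is_prime (edge_ideal x y 1).
Proof.
move=> xy; split; first exact: edge_ideal_is_ideal.
  by rewrite -mpolyX0 => /monomial_idealX; rewrite /= edge_deg0.
move=> f g fg; have [|Hf] := pselect (edge_ideal x y 1 f); first by left.
by right; apply: order_ideal_prime fg Hf.
Qed.

(* The monomial q is a unit in the localization at the prime (x, y). *)
Lemma edge_complement x y (q := \prod_(z | (z != x) && (z != y)) 'X_(rk z) : R) :
  sedge x y -> [/\ forall k, ~ edge_ideal x y 1 (q ^+ k), J (q * 'X_(rk x))
    & J (q * 'X_(rk y))].
Proof.
move=> xy; have nxy : x != y by apply: contraTneq xy => ->; rewrite sedge_irr.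
have cov z : vertex_cover (~: [set z]).
  move=> u v uv; rewrite !inE -negb_and; apply: contraTN uv => /andP[/eqP -> /eqP ->].
  by rewrite sedge_irr.
split=> [k||]; rewrite /q ?prod_varE.
- rewrite mpolyXn => /monomial_idealX; rewrite /= /edge_deg !mulmnE.
  pose P z := (z != x) && (z != y).
  by rewrite !(mnm_sum_varE P) /P !eqxx /= andbF.
- apply: ideal_gen_sub; exists (~: [set y]) => //.
  rewrite -prod_varE [RHS](bigD1 x) /=; last by rewrite !inE.
  rewrite mulrC; congr (_ * _); apply: eq_bigl => z.
  by rewrite !inE andbC.
apply: ideal_gen_sub; exists (~: [set x]) => //.
rewrite -prod_varE [RHS](bigD1 y) /=; last by rewrite !inE eq_sym.
rewrite mulrC; congr (_ * _); apply: eq_bigl => z.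
by rewrite !inE.
Qed.

(** The prime [(x, y)] is associated, being [J : q]. Conversely, given an associated prime
    [p = J : h], choose an edge whose prime misses [h]: then [q^k] is outside [p] and carries [f]
    into [J^k]. *)
Lemma symbolic_cover_ideal k f :
  symbolic_power J k f <-> forall x y, sedge x y -> edge_ideal x y k f.
Proof.
have frac (a s f' : R) : s != 0 ->
    FracField.tofrac f' = FracField.tofrac a / FracField.tofrac s <-> s * f' = a.
  move=> s0; have s0' : FracField.tofrac s != 0 by rewrite tofrac_eq0.
  split=> [e|<-]; last by rewrite tofracM mulrAC mulfV ?mul1r.
  by apply/eqP; rewrite -tofrac_eq tofracM e mulrC divfK.
have nz I s : is_ideal I -> ~ I s -> s != 0 :> R.
  by move=> [I0 _ _] Is; apply/eqP => s0; apply: Is; rewrite s0.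
split=> [Hf x y xy|Hf p [[idp p1 _] [h Hp]]].
  have [qn Jx Jy] := edge_complement xy; set q := \prod_(z | _) _ in qn Jx Jy.
  have qass : associated_prime J (edge_ideal x y 1).
    split; first exact: edge_ideal_prime.
    exists q => g; split=> [Hg|/(cover_ideal_edge xy)].
      have [J0 JD JM] := cover_ideal_is_ideal.
      apply: (mpoly_ideal_ind (P := fun g => J (g * q))).
        split=> [|a b|a b]; rewrite ?mul0r ?mulrDl -?mulrA; auto.
      move=> m mg; have := Hg m mg; rewrite /= /edge_deg => mxy.
      have [v mv Jv] : exists2 v, (U_(rk v) <= m)%MM & J (q * 'X_(rk v)).
        case: (posnP (m (rk x))) => mx.
          by exists y => //; rewrite lep1mP -lt0n; move: mxy; rewrite mx add0n.
        by exists x => //; rewrite lep1mP -lt0n.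
      by rewrite -(submK mv) mpolyXD -mulrA ['X_[_] * q]mulrC; apply: JM.
    rewrite mulrC => gq; apply: order_ideal_prime gq _.
    by have := qn 1%N; rewrite expr1.
  have [a [s [Ja ns fE]]] := Hf _ qass.
  have s0 := nz (edge_ideal x y 1) s (edge_ideal_is_ideal _ _ _) ns.
  (* [s * f] lies in [J^k], hence in [(x, y)^k], and [s] outside [(x, y)] cancels. *)
  apply: (@order_ideal_prime _ _ _ _ s) ns.
  rewrite ((frac _ _ _ s0).1 fE).
  elim: k a Ja {Hf fE} => [a _ m //|k IH].
  move=> a; apply: ideal_gen_min; first exact: edge_ideal_is_ideal.
  move=> _ [b [c [Jb /IH Hc ->]]].
  by rewrite -add1n; apply: order_idealM => //; apply: cover_ideal_edge.
have nh : ~ J h by move=> Jh; apply: p1; apply/Hp; rewrite mul1r.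
have [x [y [xy nhxy]]] : exists x y, sedge x y /\ ~ edge_ideal x y 1 h.
  apply: contrapT => nex; apply: nh; apply: cover_idealP => x y xy.
  by apply: contrapT => nhxy; apply: nex; exists x, y.
have [qn Jx Jy] := edge_complement xy; set q := \prod_(z | _) _ in qn Jx Jy.
have nps : ~ p (q ^+ k).
  move=> /Hp; rewrite mulrC => /(cover_ideal_edge xy) /order_ideal_prime.
  by move=> /(_ nhxy); apply: qn.
exists (q ^+ k * f), (q ^+ k); split=> //; last by apply/frac; rewrite ?(nz _ _ idp).
have [P0 PD PM] := ideal_powP J k.
apply: (mpoly_ideal_ind (P := fun f => ideal_pow J k (q ^+ k * f))).
  by split=> [|a b|a b]; rewrite ?mulr0 ?mulrDr ?[q ^+ k * (a * b)]mulrCA; auto.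
move=> m mf; have nxy : rk x != rk y.
  by rewrite (inj_eq enum_rank_inj); apply: contraTneq xy => ->; rewrite sedge_irr.
(* With [k = a + b], [q^k x^a y^b = (q x)^a (q y)^b] is a product of [k] elements of [J]. *)
have [a [b [-> abm]]] := edge_deg_split nxy (Hf x y xy m mf).
rewrite -(submK abm) !mpolyXD -!mpolyXn exprD mulrCA.
have [_ _ {}PM] := ideal_powP J (a + b); apply: PM.
rewrite mulrACA -!exprMn.
by apply: ideal_powD; apply: ideal_powX.
Qed.

End SymbolicPowers.

(** * Linear resolutions *)

(** Packs a lexicographic order into one number, since positions are ranked in [nat]. *)
Lemma ltn_lex n a b x y : (x < n)%N -> (y < n)%N ->
  (a * n + x < b * n + y)%N = (a < b)%N || ((a == b) && (x < y))%N.
Proof.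
move=> xn yn; have [ab|ba|->] /= := ltngtP a b; last by rewrite ltn_add2l.
  by have := leq_mul ab (leqnn n); rewrite mulSn; lia.
by have := leq_mul ba (leqnn n); rewrite mulSn; lia.
Qed.

Section LinearSyzygies.
Variables (K : fieldType) (n : nat).
Local Notation R := {mpoly K[n]}.
Implicit Types (L : {set 'I_n}) (f g : R).

Definition var_ideal L : R -> Prop :=
  monomial_ideal (fun m => exists2 x, x \in L & 0 < m x)%N.

Lemma var_idealP L : is_ideal (var_ideal L).
Proof.
apply: monomial_idealP => m m' /mnm_lepP le [x xL mx]; exists x => //.
exact: leq_trans (le x).
Qed.

Lemma var_idealX L x : x \in L -> var_ideal L 'X_x.
Proof. by move=> xL; apply/monomial_idealX; exists x; rewrite ?mnm1E ?eqxx. Qed.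

Lemma var_ideal_regular L x f : x \notin L -> var_ideal L ('X_x * f) -> var_ideal L f.
Proof.
move=> xL Hf m mf; have [|y yL] := Hf (U_(x) + m)%MM.
  by rewrite mulrC mcoeff_msupp mcoeffMX -mcoeff_msupp.
rewrite mnmDE mnm1E; have [xy|_] := eqVneq x y; first by rewrite xy yL in xL.
by exists y.
Qed.

Lemma pihomogMr d e f g :
  g \is e.-homog -> pihomog mdeg (d + e) (f * g) = pihomog mdeg d f * g.
Proof.
move=> ge; rewrite [f]mpolyE mulr_suml !raddf_sum mulr_suml /=.
apply: eq_bigr => m _; rewrite -scalerAl !linearZ -scalerAl /=; congr (_ *: _).
have Xg : 'X_[m] * g \is (mdeg m + e).-homog by apply: dhomogM; rewrite ?dhomogX.
rewrite pihomogX; case: eqP => [<-|md]; first by rewrite pihomog_dE.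
by rewrite mul0r (pihomog_ne0 _ Xg) // eqn_add2r; apply/eqP.
Qed.

(* Z is a submodule of R^b whose initial terms, for the position order given
   by rk, are generated by variables; 'X_x e_j is initial iff x \in L j. *)
Definition linear_syzygies b (Z : 'rV[R]_b -> Prop) : Prop :=
  exists (rk : 'I_b -> nat) (L : 'I_b -> {set 'I_n}), [/\ injective rk,
    [/\ Z 0, forall v w, Z v -> Z w -> Z (v + w) & forall a v, Z v -> Z (a *: v)],
    forall j x, x \in L j -> exists v : 'rV_b, [/\ Z v, v 0 j = 'X_x,
      forall i, (rk j < rk i)%N -> v 0 i = 0 & forall i, v 0 i \is 1.-homog] &
    forall v j, Z v -> (forall i, (rk j < rk i)%N -> v 0 i = 0) ->
      var_ideal (L j) (v 0 j)].

(* The new basis vectors are the pairs (j, x) with x \in L j, ordered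
   lexicographically; the S-pairs of (j, x) and (j, y) with y < x lift to
   syzygies with initial term 'X_y e_(j, x). *)
Lemma linear_syzygies_step b (Z : 'rV[R]_b -> Prop) : linear_syzygies Z ->
  exists b' (phi : 'M[R]_(b', b)), [/\ forall r c, phi r c \is 1.-homog,
    forall v, Z v <-> exists w, v = w *m phi &
    linear_syzygies (fun w : 'rV[R]_b' => w *m phi = 0)].
Proof.
move=> [rk [L [rk_inj [Z0 ZD ZZ] HL HZ]]].
pose T : finType := {p : 'I_b * 'I_n | p.2 \in L p.1}.
have /choice[s Hs] : forall p : T, exists v : 'rV[R]_b, [/\ Z v,
    v 0 (val p).1 = 'X_((val p).2),
    forall i, (rk (val p).1 < rk i)%N -> v 0 i = 0 &
    forall i, v 0 i \is 1.-homog].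
  by move=> [[j x] /= xL]; apply: HL.
pose key (k : 'I_#|T|) : 'I_b * 'I_n := val (enum_val k).
pose phi : 'M[R]_(#|T|, b) := \matrix_k s (enum_val k).
have phiE k i : phi k i = s (enum_val k) 0 i by rewrite mxE.
have phi1 k i : phi k i \is 1.-homog by rewrite phiE; have [] := Hs (enum_val k).
have phi_key k : phi k (key k).1 = 'X_((key k).2).
  by rewrite phiE; have [] := Hs (enum_val k).
have phi0 k i : (rk (key k).1 < rk i)%N -> phi k i = 0.
  by rewrite phiE; have [_ _ H _] := Hs (enum_val k); apply: H.
have keyL k : (key k).2 \in L (key k).1 by exact: valP (enum_val k).
have key_inj : injective key by move=> i j /val_inj /enum_val_inj.
have key_ex j x : x \in L j -> exists k, key k = (j, x).
  by move=> xL; exists (enum_rank (Sub (j, x) xL : T)); rewrite /key enum_rankK.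
have Zphi w : Z (w *m phi).
  rewrite mulmx_sum_row; elim/big_ind: _ => // k _; apply: ZZ.
  by rewrite rowK; have [] := Hs (enum_val k).
have lead j f : var_ideal (L j) f -> exists w : 'rV[R]_#|T|,
    (forall k, (key k).1 != j -> w 0 k = 0) /\ (w *m phi) 0 j = f.
  move=> Lf; pose P g := exists w : 'rV[R]_#|T|,
    (forall k, (key k).1 != j -> w 0 k = 0) /\ (w *m phi) 0 j = g.
  apply: (mpoly_ideal_ind (P := P)) => [|m /Lf [x xL mx]].
    split=> [|f1 f2 [w1 [w10 e1]] [w2 [w20 e2]]|a f1 [w1 [w10 e1]]].
    - by exists 0; rewrite mul0mx mxE; split=> // k; rewrite mxE.
    - exists (w1 + w2); rewrite mulmxDl mxE e1 e2; split=> // k kj.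
      by rewrite mxE w10 ?w20 ?addr0.
    exists (a *: w1); rewrite -scalemxAl mxE e1; split=> // k kj.
    by rewrite mxE w10 ?mulr0.
  have [k kE] := key_ex j x xL.
  exists ('X_[m - U_(x)] *: delta_mx 0 k); split=> [k' k'j|].
    have k'k : (k' == k) = false by apply: contraNF k'j => /eqP ->; rewrite kE.
    by rewrite !mxE k'k andbF mulr0.
  rewrite -scalemxAl -rowE !mxE; have := phi_key k; rewrite kE /= phiE => ->.
  by rewrite -mpolyXD submK // lep1mP -lt0n.
(* Division by the rows of [phi], clearing the entry of highest rank first. The bound [N] on the
   rows used later controls the leading terms of the lifts. *)
have span N v : Z v -> (forall i, (N <= rk i)%N -> v 0 i = 0) -> exists w,
    v = w *m phi /\ forall k, (N <= rk (key k).1)%N -> w 0 k = 0.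
  elim: N v => [|N IH] v Zv vN.
    exists 0; split=> [|k _]; last by rewrite mxE.
    by rewrite mul0mx; apply/rowP => i; rewrite vN ?mxE.
  have [j /eqP jN|noj] := pickP (fun j => rk j == N); last first.
    have [|w [ew w0]] := IH v Zv.
      by move=> i; rewrite leq_eqVlt eq_sym noj; apply: vN.
    by exists w; split=> // k kN; apply: w0; apply: ltnW.
  have [|w1 [w10 w1j]] := lead j (v 0 j).
    by apply: HZ => // i; rewrite jN; apply: vN.
  have [||w2 [ew w20]] := IH (v - w1 *m phi).
  - by apply: ZD => //; rewrite -mulNmx.
  - move=> i; rewrite leq_eqVlt => /orP[/eqP Ni|Ni].
      have <- : j = i by apply: rk_inj; rewrite jN.
      by rewrite !mxE -w1j mxE subrr.
    rewrite mxE vN // mxE mxE big1 ?oppr0 ?addr0 // => k _.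
    have [kj|/w10 ->] := eqVneq (key k).1 j; last by rewrite mul0r.
    by rewrite phi0 ?mulr0 // kj jN.
  exists (w2 + w1); rewrite mulmxDl -ew subrK; split=> // k kN.
  rewrite mxE w20 1?ltnW // w10 ?addr0 //.
  by apply: contraTneq kN => ->; rewrite jN ltnn.
exists #|T|, phi; split=> //.
  move=> v; split=> [Zv|[w ->]] //.
  have [|w [-> _]] := span (\max_i rk i).+1 v Zv; last by exists w.
  by move=> i; have := leq_bigmax (F := rk) i; lia.
pose rk' k := (rk (key k).1 * n + (key k).2)%N.
have rk'E k k' : (rk' k < rk' k')%N = (rk (key k).1 < rk (key k').1)%N ||
    ((rk (key k).1 == rk (key k').1) && ((key k).2 < (key k').2)%N).
  exact: ltn_lex.
have rk'_inj : injective rk'.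
  move=> k k' ek; apply: key_inj; move: (rk'E k k') (rk'E k' k).
  rewrite ek ltnn => /esym/norP[H1 H2] /esym/norP[H3 H4].
  have e1 : (key k).1 = (key k').1 by apply: rk_inj; lia.
  have e2 : (key k).2 = (key k').2 by apply: val_inj => /=; rewrite e1 eqxx in H2 H4; lia.
  by rewrite [key k]surjective_pairing e1 e2 -surjective_pairing.
pose L' k := [set y in L (key k).1 | (y < (key k).2)%N].
exists rk', L'; split=> //.
- split=> [|v w ev ew|a v ev]; first by rewrite mul0mx.
    by rewrite mulmxDl ev ew addr0.
  by rewrite -scalemxAl ev scaler0.
- move=> k y; rewrite inE => /andP[yL yx]; have [k2 k2E] := key_ex _ _ yL.
  have k2k : k2 != k by apply: contraTneq yx => kk; move: k2E; rewrite kk => -> /=; rewrite ltnn.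
  set j := (key k).1 in yL k2E *; set x := (key k).2 in yx.
  (* In this S-pair the entries at position [j] cancel, so [span] reduces it by rows of rank below
     [rk j]. *)
  pose v := 'X_y *: row k phi - 'X_x *: row k2 phi.
  have v2 i : v 0 i \is 2.-homog.
    by rewrite !mxE -!phiE rpredB // -[2%N]/(1 + 1)%N dhomogM // dhomogX /= mdeg1.
  have [||w0 [vE w00]] := span (rk j) v.
  - by rewrite /v !rowE -scaleNr; apply: ZD; apply: ZZ.
  - move=> i; rewrite leq_eqVlt !mxE -!phiE => /orP[/eqP/rk_inj <-|ji].
      have := phi_key k2; rewrite k2E /= => ->; rewrite phi_key -/x.
      by rewrite [X in _ - X]mulrC subrr.
    by rewrite !phi0 ?mulr0 ?subr0 // k2E.
  (* The degree-1 part of [w0] still lifts [v], whose entries are quadratic while those of [phi] are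
     linear; this makes the syzygy linear. *)
  exists ('X_y *: delta_mx 0 k - 'X_x *: delta_mx 0 k2 - map_mx (pihomog mdeg 1) w0).
  split=> [||i|i].
  - rewrite !mulmxBl -!scalemxAl -!rowE -/v.
    suff <- : v = map_mx (pihomog mdeg 1) w0 *m phi by rewrite subrr.
    apply/rowP => i; rewrite -[LHS](pihomog_dE (v2 i)) {1}vE mxE [RHS]mxE raddf_sum /=.
    by apply: eq_bigr => l _; rewrite (@pihomogMr 1 1) // [in RHS]mxE.
  - rewrite !mxE w00 ?leqnn // !eqxx /= raddf0 subr0.
    by rewrite eq_sym (negbTE k2k) mulr0 subr0 mulr1.
  - move=> ki; rewrite !mxE !eqxx /=.
    have -> : (i == k) = false by apply: contraTF ki => /eqP ->; rewrite ltnn.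
    have -> : (i == k2) = false.
      by apply: contraTF ki => /eqP ->; rewrite rk'E k2E /= ltnn eqxx /= -leqNgt ltnW.
    rewrite w00 ?raddf0 ?mulr0 ?subr0 ?addr0 //.
    by rewrite leq_eqVlt; move: ki; rewrite rk'E => /orP[->|/andP[-> _]] //; rewrite orbT.
  by rewrite !mxE !rpredB ?pihomogP // mulr_natr rpredMn // dhomogX /= mdeg1.
(* Read the relation in column [(key k).1]: lower rows at another position vanish there, and those
   at the same position contribute a variable of [L' k]. So [w 0 k] times the variable of [k] is in
   that ideal, and this variable, not in [L' k], cancels. *)
move=> w k ew wk; apply: (@var_ideal_regular _ (key k).2).
  by rewrite inE ltnn andbF.
have [I0 ID IM] := var_idealP (L' k).
have := congr1 (fun v : 'rV_b => v 0 (key k).1) ew; rewrite !mxE (bigD1 k) //=.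
rewrite phi_key mulrC => /eqP; rewrite addr_eq0 => /eqP ->.
rewrite -mulN1r; apply: (IM); elim/big_ind: _ => // i ik.
have [ki|ik'] := ltnP (rk' k) (rk' i); first by rewrite wk // mul0r.
have {ik'} : (rk' i < rk' k)%N.
  by rewrite ltn_neqAle ik' andbT; apply: contra ik => /eqP/rk'_inj ->.
rewrite rk'E => /orP[/phi0 ->|/andP[/eqP/rk_inj ij lt]]; first by rewrite mulr0.
by rewrite -ij phi_key; apply: IM; apply: var_idealX; rewrite inE lt andbT -ij keyL.
Qed.

End LinearSyzygies.

(** [linear_syzygies_step] is iterated over the polynomial ring, starting from the syzygies of [e];
    the isomorphism [psi] carries the matrices to [A]. *)
Lemma linear_syzygies_resolution (K : fieldType) (n : nat) (A : comPzRingType)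
    (psi : {rmorphism {mpoly K[n]} -> A}) (gA : nat -> A -> Prop)
    (N : lmodType A) (gN : nat -> N -> Prop) (d b0 : nat) (e : 'I_b0 -> N) :
    injective psi -> (forall a, exists f, psi f = a) ->
    (forall f, f \is 1.-homog -> gA 1%N (psi f)) -> (forall j, gN d (e j)) ->
    (forall y, exists v : 'rV[A]_b0, \sum_j v 0 j *: e j = y) ->
    linear_syzygies (fun v : 'rV[{mpoly K[n]}]_b0 => \sum_j psi (v 0 j) *: e j = 0) ->
  has_linear_resolution gA gN.
Proof.
move=> psi_inj /choice[psi' psiK] gA1 eN e_gen Z0.
set Z0' := (fun _ => _ = _) in Z0.
pose St := {s : {b : nat & 'rV[{mpoly K[n]}]_b -> Prop} | linear_syzygies (projT2 s)}.
have /choice[next Hnext] : forall s : St, exists s' : St,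
    exists phi : 'M[{mpoly K[n]}]_(projT1 (sval s'), projT1 (sval s)),
    [/\ forall r c, phi r c \is 1.-homog,
      forall v, projT2 (sval s) v <-> exists w, v = w *m phi &
      forall w, projT2 (sval s') w <-> w *m phi = 0].
  move=> [[b Z] /= /linear_syzygies_step[b' [phi [phi1 Zphi good]]]].
  by exists (exist _ (existT _ b' _) good), phi.
pose st i := iter i next (exist _ (existT _ b0 Z0') Z0 : St).
pose phi i := projT1 (cid (Hnext (st i))).
have phiP i := projT2 (cid (Hnext (st i))).
have lift b (v : 'rV[A]_b) : exists v0, v = map_mx psi v0.
  by exists (map_mx psi' v); apply/rowP => i; rewrite !mxE psiK.
have map0 b (v : 'rV[{mpoly K[n]}]_b) : map_mx psi v = 0 <-> v = 0.
  split=> [/rowP H|->]; last by rewrite map_mx0.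
  by apply/rowP => i; have := H i; rewrite !mxE -[in RHS](rmorph0 psi) => /psi_inj.
have exact_at i (v : 'rV[A]_(projT1 (sval (st i)))) v0 : v = map_mx psi v0 ->
    projT2 (sval (st i)) v0 <-> exists w, v = w *m map_mx psi (phi i).
  move=> ->; have [_ Zphi _] := phiP i; rewrite Zphi; split=> [[w ->]|[w]].
    by exists (map_mx psi w); rewrite map_mxM.
  have [w0 ->] := lift _ w; rewrite -map_mxM => /matrixP H; exists w0.
  by apply/rowP => j; apply: psi_inj; have := H 0 j; rewrite !mxE.
exists d, (fun i => projT1 (sval (st i))), (fun i => map_mx psi (phi i)), e.
split=> [||v|i v].
- by split=> // i r c; rewrite mxE; apply: gA1; have [H _ _] := phiP i; apply: H.
- exact: e_gen.
- have [v0 ev] := lift _ v; rewrite -(exact_at 0%N _ _ ev) ev /= /Z0'.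
  by under eq_bigr do rewrite mxE.
have [v0 ev] := lift _ v; rewrite -(exact_at i.+1 _ _ ev) ev -map_mxM map0.
by have [_ _ H] := phiP i; rewrite H.
Qed.

(** * Associated graded modules *)

Lemma lepm_mdeg n (m m' : 'X_{1..n}) : (m <= m')%MM -> (mdeg m <= mdeg m')%N.
Proof. by move=> /submK <-; rewrite mdegD leq_addl. Qed.

Section AssociatedGraded.
Variables (K : fieldType) (n : nat).
Local Notation R := {mpoly K[n]}.
Local Notation mm := (@max_homog_ideal K n).
Implicit Types (f g : R) (s : seq 'X_{1..n}) (I : R -> Prop).

(* The monomials of m^i I, for I generated by the monomials in s. *)
Definition adic_monomial s i (m : 'X_{1..n}) : Prop :=
  exists u, [/\ u \in s, (u <= m)%MM & (mdeg u + i <= mdeg m)%N].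

Lemma adic_monomial_le s i m m' :
  (m <= m')%MM -> adic_monomial s i m -> adic_monomial s i m'.
Proof.
move=> le [u [us um du]]; exists u; split=> //; first exact: lepm_trans le.
exact: leq_trans (lepm_mdeg le).
Qed.

Lemma ideal_pow_max i f : ideal_pow mm i f -> order_ideal mdeg i f.
Proof.
elim: i f => [|i IH] f; first by move=> _ m.
apply: ideal_gen_min; first exact: order_idealP.
move=> _ [a [b [ma /IH mb ->]]]; rewrite -add1n; apply: order_idealM => //.
move: ma; apply: ideal_gen_min; first exact: order_idealP.
by move=> _ [x ->]; apply/monomial_idealX; rewrite /= mdeg1.
Qed.

Lemma ideal_pow_maxX i m : (i <= mdeg m)%N -> ideal_pow mm i 'X_[m].
Proof.
elim: i m => // i IH m im.
have [x mx] : exists x, m x != 0%N.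
  apply/existsP; apply: contraTT im => /existsPn m0.
  suff -> : m = 0%MM by rewrite mdeg0.
  by apply/mnmP => x; rewrite mnm0E; apply/eqP; have := m0 x; rewrite negbK.
have xm : (U_(x) <= m)%MM by rewrite lep1mP.
rewrite -(submK xm) addmC mpolyXD; apply: ideal_mulM.
  by apply: ideal_gen_sub; exists x.
apply: IH; move: im; rewrite -{1}(submK xm) mdegD mdeg1; lia.
Qed.

Lemma adicE I s i f :
    (forall g, I g <-> monomial_ideal (fun m => exists2 u, u \in s & (u <= m)%MM) g) ->
  adic mm I i f <-> monomial_ideal (adic_monomial s i) f.
Proof.
move=> IE; have idD := @monomial_idealP K n _ (@adic_monomial_le s i).
split.
  apply: ideal_gen_min => // _ [a [b [/ideal_pow_max ma /IE Ib ->]]].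
  move=> m /msuppM_le/allpairsP[[m1 m2] /= [/ma m1i /Ib[u us um] ->]].
  exists u; split=> //; first exact: lepm_trans um (lem_addl _ _).
  by rewrite mdegD addnC; apply: leq_add => //; apply: lepm_mdeg.
move=> Hf; apply: mpoly_ideal_ind (adic_ideal _ _ _) _ => m /Hf[u [us um du]].
rewrite -(submK um) mpolyXD; apply: ideal_mulM; last first.
  by apply/IE/monomial_idealX; exists u; rewrite ?lepm_refl.
by apply: ideal_pow_maxX; move: du; rewrite -{1}(submK um) mdegD; lia.
Qed.

Lemma adic1E i f : adic mm (fun=> True) i f <-> order_ideal mdeg i f.
Proof.
rewrite (@adicE _ [:: 0%MM]) => [|g]; last first.
  split=> // _ m _; exists 0%MM; rewrite ?inE //.
  by apply/mnm_lepP => x; rewrite mnm0E.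
split=> H m /H => [[u [/[!inE] /eqP -> _]]|mi]; first by rewrite mdeg0 add0n.
exists 0%MM; rewrite inE mdeg0 add0n; split=> //.
by apply/mnm_lepP => x; rewrite mnm0E.
Qed.

Fact gsplit_rees f : gsplit mdeg f \in rees_pred mm (fun=> True).
Proof.
apply/asboolP => i; apply/adic1E => m; rewrite coef_gsplit mcoeff_msupp.
by rewrite mcoeff_pihomog; case: (_ =P i) => [->//|_]; rewrite eqxx.
Qed.

Lemma gr_class_coefP I (p q : rees mm I) : gr_class p = gr_class q <->
  forall i, adic mm I i.+1 ((rees_val p)`_i - (rees_val q)`_i).
Proof. by rewrite gr_classP; split=> H i; have := H i; rewrite coefB. Qed.

(** The isomorphism of [R] with its associated graded ring: each homogeneous component goes to its
    class in [m^i / m^(i+1)]. *)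
Definition to_gr f : gr_ring mm := gr_class (Rees (gsplit_rees f)).

Fact to_gr_is_zmod_morphism : zmod_morphism to_gr.
Proof.
move=> f g; apply/eqP; rewrite eq_sym subr_eq; apply/eqP.
rewrite /to_gr -[RHS]gr_classD; congr gr_class; apply: val_inj => /=.
by rewrite gsplitB subrK.
Qed.
HB.instance Definition _ :=
  GRing.isZmodMorphism.Build R (gr_ring mm) to_gr to_gr_is_zmod_morphism.

Fact to_gr_is_monoid_morphism : monoid_morphism to_gr.
Proof.
split=> [|f g].
  rewrite -[RHS]/(gr_one mm) /gr_one; congr gr_class.
  by apply: val_inj; rewrite /= rmorph1.
rewrite -[RHS]/(gr_mul (to_gr f) (to_gr g)) gr_mulE; congr gr_class.
by apply: val_inj; rewrite /= rmorphM.
Qed.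
HB.instance Definition _ :=
  GRing.isMonoidMorphism.Build R (gr_ring mm) to_gr to_gr_is_monoid_morphism.

Lemma to_gr_inj : injective to_gr.
Proof.
move=> f g /gr_class_coefP H; apply/mpolyP => m; apply/eqP; rewrite -subr_eq0.
apply/negPn/negP => ne.
have /(_ m) : order_ideal mdeg (mdeg m).+1 (pihomog mdeg (mdeg m) f - pihomog mdeg (mdeg m) g).
  by rewrite -!coef_gsplit; apply/adic1E; apply: H.
rewrite mcoeff_msupp mcoeffB !mcoeff_pihomog eqxx.
by move=> /(_ ne); rewrite ltnn.
Qed.

Lemma to_gr_surj a : exists f, to_gr f = a.
Proof.
rewrite -[a]gr_class_repr; set p := repr a; have /asboolP Hp := valP p.
(* The [i]-th coefficient lies in [m^i], so modulo [m^(i+1)] only its component of degree [i]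
   counts. *)
exists (\sum_(i < size (rees_val p)) pihomog mdeg i (rees_val p)`_i).
apply/gr_class_coefP => i; apply/adic1E => m; set F := \sum_(_ < _) _.
have -> : (rees_val (Rees (gsplit_rees F)))`_i = pihomog mdeg i F by exact: coef_gsplit.
rewrite mcoeff_msupp mcoeffB mcoeff_pihomog raddf_sum /=.
case: (mdeg m =P i) => [mi|/eqP mi]; last first.
  rewrite sub0r oppr_eq0 => pm; rewrite ltn_neqAle eq_sym mi.
  by have /adic1E := Hp i; apply; rewrite mcoeff_msupp.
have -> : \sum_(j < size (rees_val p)) (pihomog mdeg j (rees_val p)`_j)@_m =
    (rees_val p)`_i@_m.
  under eq_bigr do rewrite mcoeff_pihomog.
  have [ip|ip] := ltnP i (size (rees_val p)).
    rewrite (bigD1 (Ordinal ip)) //= mi eqxx big1 ?addr0 // => j ji.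
    by rewrite eq_sym -[i]/(val (Ordinal ip)) val_eqE (negbTE ji).
  rewrite (nth_default 0 ip) mcoeff0 big1 // => j _; rewrite ifF //.
  by rewrite /= mi gtn_eqF // (leq_trans (ltn_ord j)).
by rewrite subrr eqxx.
Qed.

Lemma gr_piece_to_gr f : f \is 1.-homog -> @gr_piece R mm (fun=> True) 1 (to_gr f).
Proof.
move=> f1; exists f, (Rees (gsplit_rees f)); split=> //=.
apply/polyP => t; rewrite coef_gsplit coefZ coefXn.
have [->|t1] := eqVneq t 1%N; first by rewrite pihomog_dE ?mulr1.
by rewrite (pihomog_ne0 _ f1) ?mulr0 // eq_sym.
Qed.

Lemma gr_class_sum I (T : Type) (r : seq T) (F : T -> gr mm I) (G : T -> {poly R}) :
    (forall j, exists2 q, gr_class q = F j & rees_val q = G j) ->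
  exists2 q, gr_class q = \sum_(j <- r) F j & rees_val q = \sum_(j <- r) G j.
Proof.
move=> H; elim: r => [|j r [q qF qG]]; rewrite ?big_nil ?big_cons.
  by exists 0 => //; apply: (addrI (gr_class 0)); rewrite -gr_classD !addr0.
have [q' <- <-] := H j.
by exists (q' + q); rewrite ?gr_classD ?qF -?qG.
Qed.

End AssociatedGraded.

(** * The graded module of a monomial ideal with linear quotients *)

Section LinearQuotients.
Variables (K : fieldType) (n : nat) (C : 'X_{1..n} -> Prop) (s : seq 'X_{1..n}).
Hypothesis C_up : forall m m', (m <= m')%MM -> C m -> C m'.
Hypothesis sC : lin_quotients C s.
Local Notation R := {mpoly K[n]}.
Local Notation mm := (@max_homog_ideal K n).
Local Notation I := (@monomial_ideal K n C).
Local Notation u j := (nth 0%MM s j).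
Local Notation r := (size s).

Lemma adic_lin_quotients i f : adic mm I i f <-> monomial_ideal (adic_monomial s i) f.
Proof.
have [sub gen _] := sC; apply: adicE => g; split=> H m /H.
  by move/gen => [v vs vm]; exists v.
by move=> [v /sub Cv vm]; apply: C_up Cv.
Qed.

Fact gen_rees (j : 'I_r) : ('X_[u j] : R)%:P \in rees_pred mm I.
Proof.
apply/asboolP => i; apply/adic_lin_quotients; rewrite coefC.
case: eqP => [->|_]; last by move=> m; rewrite msupp0.
by apply/monomial_idealX; exists (u j); rewrite mem_nth ?lepm_refl ?addn0.
Qed.

(** Generators of all degrees sit in [I / m I], the degree-0 piece; hence the resolution starts at
    [d = 0]. *)
Definition gen_gr (j : 'I_r) : gr mm I := gr_class (Rees (gen_rees j)).

Definition comp_sum t (v : 'rV[R]_r) : R := \sum_j pihomog mdeg t (v 0 j) * 'X_[u j].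

Lemma comp_sumD t : {morph comp_sum t : v w / v + w}.
Proof.
move=> v w; rewrite -big_split; apply: eq_bigr => j _.
by rewrite mxE raddfD mulrDl.
Qed.

Lemma comp_sum_delta t a j : comp_sum t (a *: delta_mx 0 j) = pihomog mdeg t a * 'X_[u j].
Proof.
rewrite /comp_sum (bigD1 j) //= !mxE !eqxx mulr1 big1 ?addr0 // => i ij.
by rewrite !mxE (negbTE ij) mulr0 raddf0 mul0r.
Qed.

Lemma gen_grE (v : 'rV[R]_r) : exists2 q : rees mm I,
  gr_class q = \sum_j to_gr (v 0 j) *: gen_gr j &
  forall t, (rees_val q)`_t = comp_sum t v.
Proof.
have [|q qE qv] := @gr_class_sum K n I _ (index_enum 'I_r)
    (fun j => to_gr (v 0 j) *: gen_gr j)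
    (fun j => gsplit mdeg (v 0 j) * ('X_[u j])%:P).
  by move=> j; eexists; [symmetry; apply: gr_mulE | ].
exists q => // t; rewrite qv coef_sum; apply: eq_bigr => j _.
by rewrite coefMC coef_gsplit.
Qed.

Lemma gen_gr_ker (v : 'rV[R]_r) : \sum_j to_gr (v 0 j) *: gen_gr j = 0 <->
  forall t, monomial_ideal (adic_monomial s t.+1) (comp_sum t v).
Proof.
have [q <- qv] := gen_grE v.
have g0 : gr_class (0 : rees mm I) = 0.
  by apply: (addrI (gr_class 0)); rewrite -gr_classD !addr0.
rewrite -g0 gr_class_coefP; split=> H t; have := H t.
  by move=> /adic_lin_quotients; rewrite coef0 subr0 qv.
by move=> Ht; apply/adic_lin_quotients; rewrite coef0 subr0 qv.
Qed.

(** A monomial [m] of degree exactly [mdeg u + i] gets the coefficient [m / u] at [u]; one of larger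
    degree is already in [m^(i+1) I] and gets 0. *)
Lemma approx_gens i f : monomial_ideal (adic_monomial s i) f ->
  exists v : 'rV[R]_r, (forall j, v 0 j \is i.-homog) /\
    monomial_ideal (adic_monomial s i.+1) (f - \sum_j v 0 j * 'X_[u j]).
Proof.
have [D0 DD DM] := @monomial_idealP K n _ (@adic_monomial_le n s i.+1).
pose P f := exists v : 'rV[R]_r, (forall j, v 0 j \is i.-homog) /\
    monomial_ideal (adic_monomial s i.+1) (f - \sum_j v 0 j * 'X_[u j]).
move=> Hf; suff : P (\sum_(m <- msupp f) f@_m *: 'X_[m]) by rewrite -mpolyE.
rewrite big_seq; elim/big_ind: _ => [|f1 f2 [v1 [h1 d1]] [v2 [h2 d2]]|m /Hf].
- exists 0; split=> [j|]; first by rewrite mxE dhomog0.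
  by rewrite big1 ?subr0 // => j _; rewrite mxE mul0r.
- exists (v1 + v2); split=> [j|]; first by rewrite mxE dhomogD.
  have -> : f1 + f2 - \sum_j (v1 + v2) 0 j * 'X_[u j] =
      (f1 - \sum_j v1 0 j * 'X_[u j]) + (f2 - \sum_j v2 0 j * 'X_[u j]).
    rewrite addrACA -opprD -big_split; congr (_ - _).
    by apply: eq_bigr => j _; rewrite mxE mulrDl.
  exact: DD.
move=> [w [/nthP-/(_ 0%MM)[j js <-{w}] um du]]; pose j' := Ordinal js.
move: du; rewrite leq_eqVlt => /orP[/eqP du|du].
  exists ((f@_m *: 'X_[m - u j]) *: delta_mx 0 j'); split=> [l|].
    have hX : ('X_[m - u j] : R) \is i.-homog.
      rewrite dhomogX; apply/eqP/(@addnI (mdeg (u j))).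
      by rewrite du /= -{2}(submK um) mdegD addnC.
    by rewrite !mxE eqxx /= mulr_natr; apply/rpredMn/dhomogZ.
  rewrite (bigD1 j') //= !mxE !eqxx mulr1 -scalerAl -mpolyXD submK // big1.
    by rewrite addr0 subrr.
  by move=> l lj; rewrite !mxE (negbTE lj) !mulr0 mul0r.
exists 0; split=> [l|]; first by rewrite mxE dhomog0.
rewrite big1 ?subr0 => [|l _]; last by rewrite mxE mul0r.
rewrite -mul_mpolyC; apply: DM; apply/monomial_idealX.
by exists (u j); rewrite mem_nth // addnS.
Qed.

Lemma gen_gr_surj y : exists v : 'rV[gr_ring mm]_r, \sum_j v 0 j *: gen_gr j = y.
Proof.
rewrite -[y]gr_class_repr; set p := repr y; have /asboolP Hp := valP p.
have /choice[v Hv] i := approx_gens ((adic_lin_quotients _ _).1 (Hp i)).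
pose V := \sum_(i < size (rees_val p)) v i.
have [q qV qc] := gen_grE V.
exists (map_mx (@to_gr K n) V); under eq_bigr do rewrite mxE; rewrite -qV.
apply/gr_class_coefP => t; apply/adic_lin_quotients; rewrite qc.
have VE j : pihomog mdeg t (V 0 j) = if (t < size (rees_val p))%N then v t 0 j else 0.
  rewrite summxE raddf_sum /=; case: ltnP => tp.
    rewrite (bigD1 (Ordinal tp)) //= pihomog_dE ?big1 ?addr0; try by have [] := Hv t.
    move=> i it; have [hi _] := Hv i; rewrite (pihomog_ne0 _ (hi j)) //.
  rewrite big1 // => i _; have [hi _] := Hv i; rewrite (pihomog_ne0 _ (hi j)) //.
  by rewrite ltn_eqF // (leq_trans (ltn_ord i)).
have [_ Ht] := Hv t; rewrite /comp_sum; under eq_bigr do rewrite VE.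
case: ltnP => tp; last first.
  rewrite nth_default // big1 ?subr0 => [m|j _]; first by rewrite msupp0.
  by rewrite mul0r.
rewrite -opprB -mulN1r.
by have [_ _] := @monomial_idealP K n _ (@adic_monomial_le n s t.+1); apply.
Qed.

Lemma gen_gr_linear_syzygies :
  linear_syzygies (fun v : 'rV[R]_r => \sum_j to_gr (v 0 j) *: gen_gr j = 0).
Proof.
have [sub gen lq] := sC.
pose L (j : 'I_r) := [set x | [exists l : 'I_r, [&& (l < j)%N,
  (u l <= u j + U_(x))%MM & u l != (u j + U_(x))%MM]]].
exists val, L; split.
- exact: val_inj.
- split=> [|v w ev ew|a v ev].
  + by rewrite big1 // => j _; rewrite mxE raddf0 scale0r.
  + transitivity (\sum_j to_gr (v 0 j) *: gen_gr j + \sum_j to_gr (w 0 j) *: gen_gr j).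
      by rewrite -big_split; apply: eq_bigr => j _; rewrite mxE raddfD scalerDl.
    by rewrite ev ew addr0.
  transitivity (to_gr a *: \sum_j to_gr (v 0 j) *: gen_gr j); last by rewrite ev scaler0.
  by rewrite scaler_sumr; apply: eq_bigr => j _; rewrite mxE rmorphM scalerA.
- move=> j x; rewrite inE => /existsP[l /and3P[lj le ne]].
  pose f := (u j + U_(x) - u l)%MM; have fE : (f + u l = u j + U_(x))%MM by apply: submK.
  (* If [f] has degree at least 2, then [X_x * u_j] is in [m^2 I], so [X_x e_j] alone is a syzygy
     and the correction is 0. *)
  pose a : R := if mdeg f == 1%N then 'X_[f] else 0.
  have a1 : a \is 1.-homog by rewrite /a; case: ifP => h; rewrite ?dhomogX ?dhomog0.
  have jl : (j == l) = false by apply/eqP => jl; rewrite jl ltnn in lj.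
  exists ('X_x *: delta_mx 0 j + (- a) *: delta_mx 0 l); split.
  + apply/gen_gr_ker => t; rewrite comp_sumD !comp_sum_delta.
    have [->|t1] := eqVneq t 1%N; last first.
      rewrite !(@pihomog_ne0 _ _ _ 1) ?mul0r ?addr0 ?dhomogX /= ?mdeg1 ?dhomogN // 1?eq_sym //.
      by move=> m; rewrite msupp0.
    rewrite !pihomog_dE ?dhomogN ?dhomogX /= ?mdeg1 // mulNr -mpolyXD addmC.
    rewrite /a; case: eqP => f1.
      by rewrite -mpolyXD fE subrr => m; rewrite msupp0.
    rewrite mul0r subr0; apply/monomial_idealX; exists (u l); split=> //.
      by rewrite mem_nth.
    have f0 : f != 0%MM by apply: contra ne => /eqP f0; rewrite -fE f0 add0m.
    rewrite -fE mdegD addnC leq_add2r.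
    by move: f0 f1; rewrite -mdeg_eq0; case: (mdeg f) => [|[]].
  + by rewrite !mxE !eqxx jl /= mulr1 mulr0 addr0.
  + move=> i ji; rewrite !mxE /=.
    have -> : (i == j) = false by apply/eqP => ij; rewrite ij ltnn in ji.
    have -> : (i == l) = false by apply/eqP => il; move: ji; rewrite il ltnNge ltnW.
    by rewrite !mulr0 addr0.
  move=> i; rewrite !mxE !mulr_natr rpredD // rpredMn //.
    by rewrite dhomogX /= mdeg1.
  by rewrite dhomogN.
move=> v j /gen_gr_ker ker v0 m mv.
have inL i : (i < j)%N -> (u i <= m + u j)%MM -> exists2 x, x \in L j & (0 < m x)%N.
  move=> ij /mnm_lepP le; have [|l [y [lj lt le' ne]]] := lq i j; first by rewrite ij /=.
  exists y; last by have := le y; rewrite mnmDE; move: lt; clear; lia.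
  rewrite inE; apply/existsP; exists (Ordinal (ltn_trans lj (ltn_ord j))).
  by rewrite lj le'; apply/eqP.
(* A generator of smaller degree dividing m * u_j may come after u_j; linear
   quotients replace it by earlier ones, without raising the degree. *)
have descent i : (i < r)%N -> (u i <= m + u j)%MM -> (mdeg (u i) < mdeg (u j))%N ->
    exists2 x, x \in L j & (0 < m x)%N.
  have [N] := ubnP i; elim: N i => // N IH i iN ir le dlt.
  have [ij|ji|ij] := ltngtP i j; first exact: (inL i).
    have [|l [x [li lt le' ne]]] := lq j i; first by rewrite ji.
    apply: (IH l); [lia | lia | apply/mnm_lepP => y |].
      have /mnm_lepP/(_ y) := le'; have /mnm_lepP/(_ y) := le; rewrite !mnmDE mnm1E.
      by have [xy|_] := eqVneq x y; [move: lt; rewrite xy|]; lia.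
    apply: leq_ltn_trans dlt; have := lepm_mdeg le'.
    rewrite leq_eqVlt mdegD mdeg1 addn1 ltnS => /orP[/eqP e|//]; case: ne.
    have : (u i + U_(x) - u l == 0)%MM.
      by rewrite -mdeg_eq0; have := congr1 mdeg (submK le'); rewrite !mdegD mdeg1; lia.
    by move=> /eqP e0; rewrite -(submK le') e0 add0m.
  by rewrite ij ltnn in dlt.
pose t := mdeg m.
(* If [m * u_j] survives in the sum, it lies in [m^(t+1) I], so a generator of smaller degree than
   [u_j] divides it. Otherwise it cancels against a term of some [u_i], where [i < j] because [j] is
   the top position. *)
have [Hm|] := boolP ((m + u j)%MM \in msupp (comp_sum t v)).
  have [w [/(nthP 0%MM)[i ir <-] le d]] := ker t _ Hm.
  by apply: (descent i) => //; move: d; rewrite mdegD -/t addnS [(_ + t)%N]addnC ltn_add2l.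
rewrite -mcoeff_eq0 /comp_sum raddf_sum (bigD1 j) //= addmC addr_eq0.
rewrite mcoeffMX mcoeff_pihomog eqxx => /eqP e.
have /hasP : has (fun i : 'I_r => (i != j) &&
    ((pihomog mdeg t (v 0 i) * 'X_[u i])@_(u j + m) != 0)) (index_enum 'I_r).
  apply: contraT => /hasPn H; move: mv; rewrite mcoeff_msupp e oppr_eq0 big1 ?eqxx //.
  move=> i ij; apply/eqP; have := H i (mem_index_enum i).
  by rewrite ij /= negbK.
move=> [i _ /andP[ij]]; rewrite -mcoeff_msupp => /msuppM_le/allpairsP[[m1 m2] /= [m1v]].
rewrite msuppX inE => /eqP -> e2.
have lt : (i < j)%N.
  rewrite ltnNge leq_eqVlt; apply/negP => /orP[/eqP/val_inj ji|/v0 vi0].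
    by rewrite ji eqxx in ij.
  by move: m1v; rewrite vi0 raddf0 msupp0.
by apply: (inL i) => //; rewrite addmC e2 lem_addl.
Qed.

Lemma koszul_lin_quotients : koszul mm I.
Proof.
apply: (linear_syzygies_resolution (psi := to_gr (K := K) (n := n)) (d := 0) (e := gen_gr)).
- exact: to_gr_inj.
- exact: to_gr_surj.
- exact: gr_piece_to_gr.
- move=> j; exists 'X_[u j], (Rees (gen_rees j)); split=> //=.
  by rewrite expr0 alg_polyC.
- exact: gen_gr_surj.
exact: gen_gr_linear_syzygies.
Qed.

End LinearQuotients.

(** * Whiskered graphs *)

Lemma subset_codom_map (T U : eqType) (g : T -> U) (c : seq U) :
  (forall y, y \in c -> exists x, g x = y) -> exists c', c = map g c'.
Proof.
elim: c => [|y c IH] H; first by exists [::].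
have [x <-] := H y (mem_head _ _).
have [y' y'c|c' ->] := IH; first by apply: H; rewrite inE y'c orbT.
by exists (x :: c').
Qed.

Lemma whisker_lin_quotients (G : sgraph) (S : {set G}) (w : G -> nat) k :
    cycle_cover S -> (forall x, (0 < w x)%N = (x \in S)) ->
  exists s, lin_quotients (fun m : 'X_{1..#|whisker w|} =>
    forall x y : whisker w, sedge x y -> (k <= edge_deg (enum_rank x) (enum_rank y) m)%N) s.
Proof.
move=> acyc wS; set H := whisker w.
pose e : rel 'I_#|H| := fun i j => sedge (enum_val i) (enum_val j).
pose S' : pred 'I_#|H| := fun i => if enum_val i is inl x then x \in S else false.
(* The first whisker is chosen at each vertex of [S]; elsewhere the value [i] is a mere default. *)
have /choice[end_of endP] : forall i : 'I_#|H|, exists j : 'I_#|H|, S' i -> exists t,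
    enum_val i = inl (tag t) /\ enum_val j = inr t.
  rewrite /S' => i; case: (enum_val i) => [x|t]; last by exists i.
  have [xS|xS] := boolP (x \in S); last by exists i.
  have wx : (0 < w x)%N by rewrite wS.
  pose t : {x : G & 'I_(w x)} := Tagged _ (Ordinal wx).
  by exists (enum_rank (inr t : H)) => _; exists t; rewrite enum_rankK.
have esym : ssrbool.symmetric e by move=> i j; apply: sedge_sym.
have eirr : irreflexive e by move=> i; apply: sedge_irr.
have endN i : S' i -> ~~ S' (end_of i).
  by move=> /endP[t [_ et]]; rewrite /S' et.
have endL i j : S' i -> e (end_of i) j -> j = i.
  move=> /endP[t [ei et]]; rewrite /e et.
  case ej : (enum_val j) => [x|//] /= /eqP xt.
  by apply: enum_val_inj; rewrite ei ej xt.
have acycS c : (2 < size c)%N -> all (predC S') c -> ~ ucycle e c.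
  move=> sz /allP cS /andP[cyc un].
  pose g (z : del S) := enum_rank (inl (val z) : H).
  have [i ic|c' ec] := @subset_codom_map _ _ g c.
    case ei : (enum_val i) => [x|t].
      have xS : x \notin S by have := cS i ic; rewrite inE /S' ei.
      by exists (Sub x xS); apply: enum_val_inj; rewrite enum_rankK ei.
    (* A whisker end on the cycle would be followed by its base vertex, which lies in [S]. *)
    have := next_cycle cyc ic; rewrite /e ei.
    have := cS (next c i); rewrite mem_next => /(_ ic); rewrite inE /S'.
    case: (enum_val _) => [x|t'] //= xS /eqP xt; case/negP: xS.
    by rewrite -wS xt; case: (w _) (tagged t) => [[]|].
  apply: (acyc c'); first by rewrite ec size_map in sz.
  rewrite /ucycle -(map_inj_uniq (f := g)) -?ec ?un ?andbT.
    by move: cyc; rewrite ec cycle_map; apply: sub_cycle => x y;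
      rewrite /relpre /= /e !enum_rankK.
  by move=> x y /enum_rank_inj [] /val_inj.
(* Constant weight on the edges makes every whisker dominant. *)
pose W i j := if e i j then k else 0%N.
have [|s [q _]] := admissible_lin_quotients esym eirr endN endL acycS (W := W).
  split=> [i j|i j|i j Si]; rewrite /W; first by rewrite esym.
    by case: ifP.
  have [t [ei et]] := endP i Si.
  by rewrite {2}/e ei et /= eqxx; case: ifP.
exists s; have -> : (fun m : 'X_{1..#|H|} => forall x y : H, sedge x y ->
    (k <= edge_deg (enum_rank x) (enum_rank y) m)%N) = wcover W; last by [].
apply/funext => m; apply/propext; rewrite /wcover /W /edge_deg; split=> Hm.
  move=> i j; case: ifP => // eij; have := Hm _ _ eij.
  by rewrite !enum_valK.
by move=> x y xy; have := Hm (enum_rank x) (enum_rank y); rewrite /e !enum_rankK xy.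
Qed.

Theorem theorem3p10 (K : fieldType) (K_infinite : infinite_field K)
  (G : sgraph) (S : {set G}) (S_cover : cycle_cover S)
  (w : G -> nat) (w_whiskers : forall x : G, (0 < w x)%N = (x \in S))
  (k : nat) (k_pos : (1 <= k)%N) :
  koszul (@max_homog_ideal K #|whisker w|)
         (symbolic_power (@cover_ideal K (whisker w)) k).
Proof.
have [s qs] := whisker_lin_quotients k S_cover w_whiskers.
set C := (fun _ => _) in qs.
have -> : symbolic_power (@cover_ideal K (whisker w)) k = @monomial_ideal K _ C.
  apply/funext => f; apply/propext; rewrite symbolic_cover_ideal.
  by split=> [H m mf x y xy|H x y xy m mf]; apply: H mf _ _ _ || apply: H mf.
apply: koszul_lin_quotients qs => m m' /mnm_lepP le Cm x y xy.
exact: leq_trans (Cm x y xy) (leq_add _ _).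
Qed.
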